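(* Let $G=(V,E(G))$ be a random graph with vertex set $V=[n]$, let $P_{G,Q}$ be a symmetric graphical channel with graph $G$ and edge channels $Q$, and let $(X,Y)$ be a binary synchronization instance drawn from $P_{G,Q}$. Then for all $u,v\in V$, $$I_2(X_u;X_v\mid Y)\le \mathbb{P}(u\sim v\mid \gamma),$$ where $\gamma_{(i,j)}=I_2(X_i;X_j\mid Y_{(i,j)})$ for all $(i,j)\in E(G)$.
   Context: Graphical channel. Let $g=(V,E(g))$ be a finite graph with vertex set $V=[n]=\{1,\dots,n\}$. For each edge $e$, an edge channel $Q_e(\cdot\mid\cdot)$ has input alphabet $\{-1,+1\}$ and output in a measurable space $(\mathcal{Y}_e,\mathcal{A}_e)$; that is, $Q_e(\cdot\mid+1)$ and $Q_e(\cdot\mid-1)$ are probability measures on $(\mathcal{Y}_e,\mathcal{A}_e)$. For $x\in\{-1,+1\}^V$ and $e=(i,j)$ put $x_e=x_i\cdot x_j$. The graphical channel $P_{g,Q}$ has input alphabet $\{-1,+1\}^V$ and output alphabet $\prod_{e\in E(g)}\mathcal{Y}_e$, and is determined by $P_{g,Q}(\prod_e A_e\mid x)=\prod_{e\in E(g)}Q_e(A_e\mid x_e)$ for $A_e\in\mathcal{A}_e$. If $G$ is a random graph on $V=[n]$, edge channels $Q_e$ are given for every $e$ with $\mathbb{P}(e\in E(G))>0$, and $P_{G,Q}$ is the random channel equal to $P_{g,Q}$ on each realization $G=g$. Binary synchronization instance. $X$ is uniform on $\{-1,+1\}^V$ (independent of $G$), and $Y=(Y_e)_{e\in E(G)}$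 is the output of $X$ through $P_{G,Q}$. In particular $Y$ determines $G$. Symmetry. An edge channel $Q_e$ is symmetric if there is a measurable map $T_e:\mathcal{Y}_e\to\mathcal{Y}_e$ with $T_e=T_e^{-1}$ and $Q_e(A\mid+1)=Q_e(T_e(A)\mid-1)$ for all $A\in\mathcal{A}_e$. The graphical channel is symmetric if every edge channel is symmetric. $\chi^2$-mutual information. For random variables $A,B$ with joint law $\nu_{A,B}\ll\nu_A\times\nu_B$, $I_2(A;B)=\int\left(\frac{d\nu_{A,B}}{d(\nu_A\times\nu_B)}-1\right)^2 d(\nu_A\times\nu_B)$. The conditional version $I_2(A;B\mid C)$ is the expectation over $C$ of the $\chi^2$-mutual information of the conditional joint law of $(A,B)$ given $C$. The quantity $I_2(X_i;X_j\mid Y_{(i,j)})$ for an edge $(i,j)$ is the one given by the single edge observation: $X_i,X_j$ are independent uniform on $\{-1,+1\}$ and $Y_{(i,j)}\sim Q_{(i,j)}(\cdot\mid X_iX_j)$. Bond percolation. Given $G$ and $\gamma:E(G)\to[0,1]$, in a bond percolation on $G$ with open probability $\gamma$ each edge $e\in E(G)$ is independently open with probability $\gamma_e$ and closed otherwise. $\mathbb{P}(u\sim v\mid\gamma)$ is the probability (over $G$ and the percolation) that $u$ and $v$ are connected by a path of open edges. *)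

(* Defs.v *)
From HB Require Import structures.
From mathcomp Require Import all_boot all_order all_algebra.
From mathcomp Require Import all_classical all_reals all_analysis measurable_realfun.

Set Implicit Arguments.
Unset Strict Implicit.
Unset Printing Implicit Defensive.

Import Order.TTheory GRing.Theory Num.Theory.
Import numFieldNormedType.Exports.

Local Open Scope classical_set_scope.
Local Open Scope charge_scope.
Local Open Scope ring_scope.

Section product_projections.
Context (d1 d2 : measure_display).
Context (T1 : measurableType d1) (T2 : measurableType d2).

HB.instance Definition _ := isMeasurableFun.Build _ _ _ _
  (@fst T1 T2) (@measurable_fst _ _ T1 T2).
HB.instance Definition _ := isMeasurableFun.Build _ _ _ _
  (@snd T1 T2) (@measurable_snd _ _ T1 T2).

End product_projections.

(* If [nu] is not dominated by the product of its marginals, the library's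
   Radon-Nikodym derivative is the constant -oo, so that the value is +oo. *)
Definition chi2_mi (R : realType) (d1 d2 : measure_display)
    (T1 : measurableType d1) (T2 : measurableType d2)
    (nu : probability (T1 * T2)%type R) : \bar R :=
  let pi : probability (T1 * T2)%type R :=
    (distribution nu (@fst T1 T2) \x distribution nu (@snd T1 T2))%E in
  (\int[pi]_z (('d (charge_of_finite_measure nu) '/d pi) z - 1) ^+ 2)%E.

Definition is_cond_law (R : realType) (dO dZ dC : measure_display)
    (Omega : measurableType dO) (TZ : measurableType dZ)
    (TC : measurableType dC) (P : probability Omega R)
    (Z : Omega -> TZ) (C : Omega -> TC) (kappa : TC -> probability TZ R) :=
  (forall S : set TZ, measurable S ->
     measurable_fun [set: TC] (kappa ^~ S)) /\
  (forall (S : set TZ) (D : set TC), measurable S -> measurable D ->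
     P (Z @^-1` S `&` C @^-1` D) =
     (\int[P]_(w in C @^-1` D) kappa (C w) S)%E).

(* A version of the conditional law; it exists and is almost surely unique when
   [TZ] is finite, the only case used below. *)
Definition cond_law (R : realType) (dO dZ dC : measure_display)
    (Omega : measurableType dO) (TZ : measurableType dZ)
    (TC : measurableType dC) (P : probability Omega R)
    (Z : Omega -> TZ) (C : Omega -> TC) : TC -> probability TZ R :=
  get (is_cond_law P Z C).

Definition cond_chi2_mi (R : realType) (dO d1 d2 dC : measure_display)
    (Omega : measurableType dO) (T1 : measurableType d1)
    (T2 : measurableType d2) (TC : measurableType dC)
    (P : probability Omega R)
    (A : {RV P >-> T1}) (B : {RV P >-> T2}) (C : {RV P >-> TC}) : \bar R :=
  (\int[P]_w chi2_mi (cond_law P (fun w' => (A w', B w')) C (C w)))%E.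
Arguments cond_chi2_mi {R dO d1 d2 dC Omega T1 T2 TC} P A B C.

(* The spin +1 is encoded as [true] and -1 as [false]; the product of two spins
   is then the boolean equality test. *)
Notation spin := bool.
Definition spin_mul (a b : spin) : spin := a == b.

(* The undirected edge {i, j} is stored as the ordered pair with i < j. *)
Definition edge (n : nat) := {p : 'I_n * 'I_n | p.1 < p.2}%N.
Definition graph (n : nat) := {set edge n}.

Definition src (n : nat) (e : edge n) : 'I_n := (val e).1.
Definition tgt (n : nat) (e : edge n) : 'I_n := (val e).2.

Section channel_output.
Context (n : nat) (d : edge n -> measure_display).
Context (Yt : forall e, measurableType (d e)).

Definition alphabet (g : graph n) := forall e : edge n, e \in g -> Yt e.

Definition raw_output := {g : graph n & alphabet g}.

HB.instance Definition _ := gen_eqMixin raw_output.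
HB.instance Definition _ := gen_choiceMixin raw_output.
HB.instance Definition _ := isPointed.Build raw_output
  (existT alphabet finset.set0 (fun e _ => (point : Yt e))).

Definition output_box (g : graph n) (A : forall e, set (Yt e)) :
    set raw_output :=
  [set y | projT1 y = g /\
    forall e (eg : e \in projT1 y), A e ((projT2 y : alphabet _) e eg)].

Definition output_boxes : set (set raw_output) :=
  [set S | exists g (A : forall e, set (Yt e)),
             (forall e, measurable (A e)) /\ S = output_box g A].

(* The disjoint union over all graphs g on 'I_n of the output alphabets
   \prod_(e in g) Yt e, with its product sigma-algebras. *)
Definition output := g_sigma_algebraType output_boxes.

Definition output_graph (y : output) : graph n := projT1 (y : raw_output).

End channel_output.

Section edge_information.
Context (R : realType) (dY : measure_display) (Y : measurableType dY).
Variable Q : spin -> probability Y R.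

(* The law of ((X_i, X_j), Y_(i,j)) for X_i, X_j independent uniform spins and
   Y_(i,j) of conditional law Q(. | X_i X_j). *)
Definition edge_law (S : set ((spin * spin) * Y)) : \bar R :=
  (\sum_(s : spin * spin)
     (4^-1)%:E * Q (spin_mul s.1 s.2) (xsection S s))%E.

Let edge_law0 : edge_law set0 = 0%E.
Proof. by rewrite /edge_law big1// => s _; rewrite xsection0 measure0 mule0. Qed.

Let edge_law_ge0 S : (0 <= edge_law S)%E.
Proof. by apply: sume_ge0 => s _; rewrite mule_ge0// lee_fin. Qed.

Let edge_law_sigma_additive : semi_sigma_additive edge_law.
Proof.
move=> F mF tF mUF.
rewrite [X in X @ _](_ : _ = (fun k => \sum_(s : spin * spin) (4^-1)%:E *
    \sum_(0 <= i < k) Q (spin_mul s.1 s.2) (xsection (F i) s))%E); last first.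
  apply/funext => k; rewrite exchange_big/=; apply: eq_bigr => s _.
  by rewrite ge0_sume_distrr.
apply: cvg_nnesum => s _.
  by near=> k; rewrite mule_ge0// ?lee_fin// sume_ge0.
apply: cvgeZl => //; rewrite xsection_bigcup.
apply: measure_semi_sigma_additive.
- by move=> k; exact: measurable_xsection.
- exact: trivIset_xsection.
- by apply: bigcupT_measurable => k; exact: measurable_xsection.
Unshelve. all: by end_near. Qed.

HB.instance Definition _ := isMeasure.Build _ _ _ edge_law
  edge_law0 edge_law_ge0 edge_law_sigma_additive.

Let edge_law_setT : edge_law [set: (spin * spin) * Y] = 1%E.
Proof.
rewrite /edge_law (eq_bigr (fun=> (4^-1)%:E)); last first.
  move=> s _; rewrite [X in Q _ X](_ : _ = setT) ?probability_setT ?mule1//.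
  by apply/seteqP; split => // y _; apply/xsectionP.
rewrite sumEFin big_const iter_addr_0 card_prod card_bool.
by rewrite -[(4^-1 *+ _)]mulr_natr mulVf ?pnatr_eq0.
Qed.

HB.instance Definition _ :=
  Measure_isProbability.Build _ _ _ edge_law edge_law_setT.

Definition edge_chi2_mi : \bar R :=
  cond_chi2_mi edge_law
    [the {mfun _ >-> _} of (@fst spin spin) \o (@fst (spin * spin)%type Y)]
    [the {mfun _ >-> _} of (@snd spin spin) \o (@fst (spin * spin)%type Y)]
    (@snd (spin * spin)%type Y).

End edge_information.

Section synchronization.
Context (R : realType) (n : nat) (d : edge n -> measure_display).
Context (Yt : forall e, measurableType (d e)).
Variable Q : forall e, spin -> probability (Yt e) R.
Context (dO : measure_display) (Omega : measurableType dO).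
Variable P : probability Omega R.

Definition symmetric_edge_channel (e : edge n) :=
  exists T : Yt e -> Yt e,
    [/\ measurable_fun [set: Yt e] T, involutive T &
        forall A, measurable A -> Q e true A = Q e false (T @` A)].

(* Only the edges that occur in the random graph with positive probability carry
   a channel; the values of [Q] at the other edges are irrelevant. *)
Definition symmetric_channel (G : Omega -> graph n) :=
  forall e, (0 < P [set w | e \in G w])%E -> symmetric_edge_channel e.

Record sync_instance (G : Omega -> graph n) (X : 'I_n -> {RV P >-> spin})
    (Y : {RV P >-> output Yt}) : Prop := {
  output_graphE : forall w, output_graph (Y w) = G w ;
  input_uniform : forall x : 'I_n -> spin,
    P [set w | forall i, X i w = x i] = ((2 ^+ n)^-1)%:E ;
  input_graph_indep : forall (x : 'I_n -> spin) (g : graph n),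
    P [set w | (forall i, X i w = x i) /\ G w = g] =
    (P [set w | forall i, X i w = x i] * P [set w | G w = g])%E ;
  (* Conditionally on X = x and G = g, the law of Y gives
     mass \prod_(e in g) Q_e(A_e | x_e) to the box \prod_(e in g) A_e. *)
  output_law : forall (x : 'I_n -> spin) (g : graph n)
      (A : forall e, set (Yt e)), (forall e, measurable (A e)) ->
    P [set w | (forall i, X i w = x i) /\ output_box g A (Y w)] =
    (P [set w | (forall i, X i w = x i) /\ G w = g] *
     \big[*%E/1%E]_(e in g) Q e (spin_mul (x (src e)) (x (tgt e))) (A e))%E
}.

(* [fine] loses nothing: the chi2-information of two spins is at most 1. *)
Definition edge_gamma (e : edge n) : R := fine (edge_chi2_mi (Q e)).

End synchronization.

Section percolation.
Context (R : realType) (n : nat).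

Definition adj (o : graph n) : rel 'I_n := fun i j =>
  [exists e in o, ((src e == i) && (tgt e == j)) ||
                  ((src e == j) && (tgt e == i))].

(* The probability that the set of open edges is exactly [o]. *)
Definition open_prob (g : graph n) (gam : edge n -> R) (o : graph n) : R :=
  (\prod_(e in o) gam e) * \prod_(e in g :\: o) (1 - gam e).

Definition conn_prob (g : graph n) (gam : edge n -> R) (u v : 'I_n) : R :=
  \sum_(o : graph n | (o \subset g) && connect (adj o) u v) open_prob g gam o.

Definition random_conn_prob (dO : measure_display) (Omega : measurableType dO)
    (P : probability Omega R) (G : Omega -> graph n) (gam : edge n -> R)
    (u v : 'I_n) : \bar R :=
  (\sum_(g : graph n) P [set w | G w = g] * (conn_prob g gam u v)%:E)%E.

End percolation.

(* Main.v *)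
Require Import Defs.
From HB Require Import structures.
From mathcomp Require Import all_boot all_order all_algebra.
From mathcomp Require Import all_classical all_reals all_analysis measurable_realfun.
From mathcomp Require Import ring lra.

(* For a symmetric channel Q let mu be the average of Q(.|+1) and Q(.|-1).  The
   statistic r = dQ(.|+1)/dmu - 1 gives dQ(.|b) = (1 + b r) dmu, is odd under the
   involution T of the channel, and satisfies gamma = int r^2 dmu.  Given the
   graph g, the posterior of X is thus proportional to prod_e (1 + x_e r_e).  It
   is invariant under a global flip, so X_u and X_v have uniform posterior
   marginals, and I_2(X_u; X_v | Y) is the mean of the square of their posterior
   correlation.  That square, times the density of Y and averaged over the sign
   of one r_e, is a linear fractional function of r_e^2 which is convex on [0, 1].
   Bounding it by its chord replaces the edge e by an erasure channel revealing
   x_e with probability r_e^2.  Once all edges are replaced, the revealed edges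
   form a bond percolation, and X_u X_v is determined if u and v are connected and
   uniform otherwise.  Integrating over the independent r_e turns r_e^2 into
   gamma_e.

   Product measures are avoided: by symmetry, the law of Y is recovered from its
   law given X = (+1, ..., +1) by applying T on a uniformly random set of edges and
   reweighting. *)

Set Implicit Arguments.
Unset Strict Implicit.
Unset Printing Implicit Defensive.

Import Order.TTheory GRing.Theory Num.Theory.
Import numFieldNormedType.Exports.

Local Open Scope ring_scope.

(** * Comparison of spin posteriors with bond percolation *)

(** The comparison is made with the magnitudes |r_e| held fixed. Since T preserves mu and reverses
    r, the law of r_e under mu is symmetric given |r_e|; the averages over sign patterns s express
    this, and the open probabilities remain the random numbers r_e^2 until the very end. The
    connection probability is affine in each open probability, so independence allows each r_e^2 to
    be replaced by its mean. As r^2 is invariant under T, its mean is gamma_e under Q(.|+1) as well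
    as under mu, and this is why the all-plus input can serve as reference.

    Two degeneracies recur. An observation may have evidence 0; the correlation is bounded by the
    evidence, so it vanishes too, and the convention x / 0 = 0 keeps the formulas valid. A
    conditional law is determined only up to null sets, so the information given Y is identified
    only almost surely. *)

Section average.
Context (R : realType).

Definition avg (I : finType) (f : I -> R) : R := (\sum_i f i) / #|I|%:R.

Lemma eq_avg (I : finType) (f g : I -> R) : f =1 g -> avg f = avg g.
Proof. by move=> fg; rewrite /avg (eq_bigr g)// => i _; rewrite fg. Qed.

Lemma avgD (I : finType) (f g : I -> R) :
  avg (fun i => f i + g i) = avg f + avg g.
Proof. by rewrite /avg big_split mulrDl. Qed.

Lemma avgZ (I : finType) (c : R) (f : I -> R) :
  avg (fun i => c * f i) = c * avg f.
Proof. by rewrite /avg -mulr_sumr mulrA. Qed.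

Lemma avgN (I : finType) (f : I -> R) : avg (fun i => - f i) = - avg f.
Proof. by rewrite /avg sumrN mulNr. Qed.

Lemma le_avg (I : finType) (f g : I -> R) :
  (forall i, f i <= g i) -> avg f <= avg g.
Proof. by move=> fg; rewrite ler_wpM2r ?invr_ge0// ler_sum. Qed.

Lemma avg_ge0 (I : finType) (f : I -> R) : (forall i, 0 <= f i) -> 0 <= avg f.
Proof. by move=> f0; rewrite mulr_ge0 ?invr_ge0// sumr_ge0. Qed.

Lemma ler_norm_avg (I : finType) (f : I -> R) :
  `|avg f| <= avg (fun i => `|f i|).
Proof.
by rewrite normrM normfV [`|#|I|%:R|]ger0_norm// ler_wpM2r ?invr_ge0// ler_norm_sum.
Qed.

Lemma avg_cst (I : finType) (i0 : I) (c : R) : avg (fun _ : I => c) = c.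
Proof.
rewrite /avg sumr_const -[c *+ _]mulr_natr mulfK// pnatr_eq0 -lt0n.
by apply/card_gt0P; exists i0.
Qed.

Lemma exchange_avg (I J : finType) (f : I -> J -> R) :
  avg (fun i => avg (f i)) = avg (fun j => avg (f^~ j)).
Proof.
rewrite /avg -!mulr_suml exchange_big/= -!mulrA; congr (_ * _).
exact: mulrC.
Qed.

Lemma avg_inv (I : finType) (h : I -> I) (f : I -> R) :
  involutive h -> avg (f \o h) = avg f.
Proof.
move=> hK; rewrite /avg [in RHS](reindex h)//.
by exists h => i _; exact: hK.
Qed.

Lemma avg_prod (I : finType) (A : {set I}) (F : I -> bool -> R) :
  avg (fun s : {ffun I -> bool} => \prod_(i in A) F i (s i)) =
  \prod_(i in A) ((F i true + F i false) / 2).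
Proof.
pose F' i b := if i \in A then F i b else 1.
rewrite /avg (eq_bigr (fun s : {ffun I -> bool} => \prod_i F' i (s i))); last first.
  by move=> s _; rewrite big_mkcond.
rewrite -bigA_distr_bigA/= card_ffun card_bool natrX -prodr_const/=.
rewrite -prodf_div [RHS]big_mkcond/=; apply: eq_bigr => i _.
rewrite big_bool /F'; case: ifP => _ //=.
by rewrite -(natrD R 1 1) divff// pnatr_eq0.
Qed.

(** Subsets of [i |: S] are sorted by whether they contain [i]; this splits percolation
    configurations by the state of one edge. *)
Lemma sum_subset_setU1 (I : finType) (i : I) (S : {set I}) (H : {set I} -> R) :
  i \notin S ->
  \sum_(o : {set I} | o \subset i |: S) H o =
  \sum_(o : {set I} | o \subset S) (H o + H (i |: o)).
Proof.
move=> iS; rewrite (bigID (fun o : {set I} => i \in o))/= big_split/= addrC.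
congr (_ + _).
  apply: eq_bigl => /= o; apply/andP/idP => [[oS io]|oS].
    apply/fintype.subsetP => j jo; move/fintype.subsetP : oS => /(_ j jo).
    by rewrite !inE => /orP[/eqP ji|//]; rewrite -ji jo in io.
  split; first exact: fintype.subset_trans oS (finset.subsetU1 _ _).
  by by apply: contra iS => /(fintype.subsetP oS).
rewrite (reindex_onto (fun o => i |: o) (fun o => o :\ i))/=; last first.
  by move=> o /andP[_ io]; rewrite finset.setD1K.
apply: eq_bigl => /= o; rewrite finset.setU11 andbT.
apply/andP/idP => [[oS /eqP <-]|oS].
  apply/fintype.subsetP => j; rewrite !inE => /andP[ji /orP[/eqP ij|jo]].
    by rewrite ij eqxx in ji.
  move/fintype.subsetP : oS => /(_ j); rewrite !inE jo orbT => /(_ isT).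
  by rewrite (negbTE ji).
split; first exact: finset.setUS.
by rewrite finset.setU1K//; apply: contra iS => /(fintype.subsetP oS).
Qed.

End average.

(** * Posterior of the spins as a function of the edge statistics *)

Section spin_posterior.
Context (R : realType) (n : nat).
Implicit Types (g o S : graph n) (r : edge n -> R) (u v : 'I_n) (e : edge n).
Implicit Types (x : {ffun 'I_n -> spin}) (s : {ffun edge n -> spin}).

Definition sgn (b : spin) : R := if b then 1 else -1.

Lemma sgnM a b : sgn (spin_mul a b) = sgn a * sgn b.
Proof. by case: a b => [] []; rewrite /sgn/= ?mulrNN ?mul1r ?mulr1. Qed.

Lemma sgnN b : sgn (~~ b) = - sgn b.
Proof. by case: b; rewrite /sgn/= ?opprK. Qed.

Lemma sqr_sgn b : sgn b ^+ 2 = 1.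
Proof. by case: b; rewrite /sgn/= ?sqrrN expr1n. Qed.

Lemma normr_sgn b : `|sgn b| = 1.
Proof. by case: b; rewrite /sgn/= ?normrN normr1. Qed.

(* Up to a common factor, [weight] is the joint density of (x, y), [evidence] the
   density of y, and [correlation] the latter times the posterior mean of
   [x_u x_v]; the observation y enters through the statistics r. *)
Definition weight g r x : R :=
  \prod_(e in g) (1 + sgn (spin_mul (x (src e)) (x (tgt e))) * r e).

Definition evidence g r : R := avg (weight g r).

Definition correlation g u v r : R :=
  avg (fun x => sgn (spin_mul (x u) (x v)) * weight g r x).

Definition chi2_density g u v r : R :=
  correlation g u v r ^+ 2 / evidence g r.

Definition upd r e (t : R) : edge n -> R := fun e' => if e' == e then t else r e'.

Lemma eq_weight g r r' x : {in g, r =1 r'} -> weight g r x = weight g r' x.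
Proof. by move=> rr'; apply: eq_bigr => e eg; rewrite rr'. Qed.

Lemma eq_evidence g r r' : {in g, r =1 r'} -> evidence g r = evidence g r'.
Proof. by move=> rr'; apply: eq_avg => x; exact: eq_weight. Qed.

Lemma eq_correlation g u v r r' :
  {in g, r =1 r'} -> correlation g u v r = correlation g u v r'.
Proof. by move=> rr'; apply: eq_avg => x; rewrite (eq_weight _ rr'). Qed.

Lemma eq_chi2_density g u v r r' :
  {in g, r =1 r'} -> chi2_density g u v r = chi2_density g u v r'.
Proof.
by move=> rr'; rewrite /chi2_density (eq_evidence rr') (eq_correlation _ _ rr').
Qed.

(** Each edge contributes one factor, so the weight is affine in each coordinate of [r]. Written
    through the values at 0 and 1, this passes unchanged to the averages [evidence] and
    [correlation]. *)
Lemma weight_upd g r e t x : weight g (upd r e t) x =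
  weight g (upd r e 0) x + t * (weight g (upd r e 1) x - weight g (upd r e 0) x).
Proof.
have [eg|eg] := boolP (e \in g); last first.
  have E t' : weight g (upd r e t') x = weight g r x.
    apply: eq_weight => e' e'g; rewrite /upd; case: eqP => // ee'.
    by rewrite ee' (negbTE eg) in e'g.
  by rewrite !E subrr mulr0 addr0.
rewrite /weight !(bigD1 e eg)/=.
have E t' : \prod_(i in g | i != e)
     (1 + sgn (spin_mul (x (src i)) (x (tgt i))) * upd r e t' i) =
   \prod_(i in g | i != e) (1 + sgn (spin_mul (x (src i)) (x (tgt i))) * r i).
  by apply: eq_bigr => i /andP[_ /negbTE ie]; rewrite /upd ie.
by rewrite !E /upd eqxx; ring.
Qed.

Lemma evidence_upd g r e t : evidence g (upd r e t) =
  evidence g (upd r e 0) + t * (evidence g (upd r e 1) - evidence g (upd r e 0)).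
Proof.
rewrite /evidence -avgN -avgD -avgZ -avgD; apply: eq_avg => x.
exact: weight_upd.
Qed.

Lemma correlation_upd g u v r e t : correlation g u v (upd r e t) =
  correlation g u v (upd r e 0) +
  t * (correlation g u v (upd r e 1) - correlation g u v (upd r e 0)).
Proof.
rewrite /correlation -avgN -avgD -avgZ -avgD; apply: eq_avg => x.
by rewrite weight_upd; ring.
Qed.

Lemma weight_ge0 g r x : {in g, forall e, `|r e| <= 1} -> 0 <= weight g r x.
Proof.
move=> r1; apply: prodr_ge0 => e eg.
have : `|sgn (spin_mul (x (src e)) (x (tgt e))) * r e| <= 1.
  by rewrite normrM normr_sgn mul1r r1.
by rewrite ler_norml => /andP[+ _]; rewrite -subr_ge0 opprK addrC.
Qed.

Lemma evidence_ge0 g r : {in g, forall e, `|r e| <= 1} -> 0 <= evidence g r.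
Proof. by move=> r1; apply: avg_ge0 => x; exact: weight_ge0. Qed.

Lemma correlation_le g u v r : {in g, forall e, `|r e| <= 1} ->
  `|correlation g u v r| <= evidence g r.
Proof.
move=> r1; apply: le_trans (ler_norm_avg _) _; apply: le_avg => x.
by rewrite normrM normr_sgn mul1r ger0_norm// weight_ge0.
Qed.

Lemma chi2_density_le g u v r : {in g, forall e, `|r e| <= 1} ->
  chi2_density g u v r <= evidence g r.
Proof.
move=> r1; have := correlation_le u v r1; have := evidence_ge0 r1.
rewrite le0r /chi2_density => /orP[/eqP->|d0 le].
  by rewrite invr0 mulr0.
by rewrite ler_pdivrMr// -expr2 -real_normK ?num_real// ler_sqr ?nnegrE// ltW.
Qed.

(* The average of the left-hand side over the sign of t is a linear fractional,
   hence convex, function of [t ^+ 2]; the right-hand side is its chord. *)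
Lemma linear_fractional_chord (a b c d t : R) :
  `|a + c| <= d + b -> `|a - c| <= d - b -> `|t| <= 1 ->
  (a + t * c) ^+ 2 / (d + t * b) + (a - t * c) ^+ 2 / (d - t * b) <=
  (1 - t ^+ 2) * (2 * (a ^+ 2 / d)) +
  t ^+ 2 * ((a + c) ^+ 2 / (d + b) + (a - c) ^+ 2 / (d - b)).
Proof.
move=> h1 h2 h3.
have db1 : 0 <= d + b by exact: le_trans h1.
have db2 : 0 <= d - b by exact: le_trans h2.
have [d0|d0] := eqVneq d 0.
  have b0 : b = 0 by lra.
  by rewrite d0 b0 !mulr0 subr0 addr0 invr0 !mulr0 !addr0 mulr0.
have dgt0 : 0 < d by rewrite lt_neqAle eq_sym d0/=; lra.
have t1 : -1 <= t <= 1 by rewrite -ler_norml.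
have t2 : t ^+ 2 <= 1 by rewrite -real_normK ?num_real// expr_le1.
(* Prepares the cases [d = b] and [d = - b], where a denominator on the right vanishes: one of the
   bounds then forces [c = a] or [c = - a], every quotient is affine in [t], and equality holds.
   With 0 / 0 = 0 the formula also covers [z = -1]. *)
have E z : (a + z * a) ^+ 2 / (d + z * d) = a ^+ 2 / d * (1 + z).
  have [z1|z1] := eqVneq (1 + z) 0.
    have -> : a + z * a = a * (1 + z) by ring.
    by rewrite z1 mulr0 expr0n mul0r mulr0.
  have -> : d + z * d = d * (1 + z) by ring.
  by field; rewrite d0.
have [db|db] := eqVneq d b.
  have ac : a = c.
    by apply/eqP; rewrite -subr_eq0 -normr_le0 (le_trans h2)// db subrr.
  rewrite -db -ac !subrr invr0 mulr0 addr0.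
  move: (E t) (E (- t)) (E 1); rewrite !mulNr !mul1r => -> -> ->.
  by rewrite le_eqVlt; apply/orP; left; apply/eqP; ring.
have [db'|db'] := eqVneq d (- b).
  have ac : a = - c.
    by apply/eqP; rewrite -addr_eq0 -normr_le0 (le_trans h1)// db' addNr.
  have -> : c = - a by rewrite ac opprK.
  have -> : b = - d by rewrite db' opprK.
  rewrite !opprK !mulrN !opprK !subrr expr0n mul0r add0r.
  move: (E t) (E (- t)) (E 1); rewrite !mulNr !mul1r => -> -> ->.
  by rewrite le_eqVlt; apply/orP; left; apply/eqP; ring.
have p1 : 0 < d + b by rewrite lt_neqAle db1 andbT eq_sym addr_eq0.
have p2 : 0 < d - b by rewrite lt_neqAle db2 andbT eq_sym subr_eq0.
have p3 : 0 < d + t * b by nra.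
have p4 : 0 < d - t * b by nra.
(* With all denominators positive, chord minus average has a closed form, a product of squares,
   [1 - t ^+ 2] and positive factors. *)
rewrite -subr_ge0.
have -> : (1 - t ^+ 2) * (2 * (a ^+ 2 / d)) +
  t ^+ 2 * ((a + c) ^+ 2 / (d + b) + (a - c) ^+ 2 / (d - b)) -
  ((a + t * c) ^+ 2 / (d + t * b) + (a - t * c) ^+ 2 / (d - t * b)) =
  2 * t ^+ 2 * (1 - t ^+ 2) * b ^+ 2 * (c * d - a * b) ^+ 2 /
  (d * (d + b) * (d - b) * (d + t * b) * (d - t * b)).
  by field; rewrite d0 !gt_eqF.
apply: divr_ge0; last by rewrite !mulr_ge0// ltW.
apply: mulr_ge0; last exact: sqr_ge0.
apply: mulr_ge0; last exact: sqr_ge0.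
by apply: mulr_ge0; [rewrite mulr_ge0 ?sqr_ge0|rewrite subr_ge0].
Qed.

(** The ends of the chord are an erased edge, with statistic 0, and a noiseless one, with statistic
    1 or -1. The slopes [b] and [c] of the chord inequality are those of evidence and correlation in
    the coordinate [e]. *)
Lemma chi2_density_chord g u v r e : (forall e, `|r e| <= 1) ->
  chi2_density g u v r + chi2_density g u v (upd r e (- r e)) <=
  (1 - r e ^+ 2) * (2 * chi2_density g u v (upd r e 0)) +
  r e ^+ 2 * (chi2_density g u v (upd r e 1) + chi2_density g u v (upd r e (-1))).
Proof.
move=> r1.
have u1 t : `|t| <= 1 -> {in g, forall e', `|upd r e t e'| <= 1}.
  by move=> t1 e' _; rewrite /upd; case: eqP.
rewrite [in X in X <= _](@eq_chi2_density g u v r (upd r e (r e))); last first.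
  by move=> e' _; rewrite /upd; case: eqP => // ->.
have h1 := @correlation_le g u v _ (u1 1 _).
have h2 := @correlation_le g u v _ (u1 (-1) _).
rewrite normrN normr1 in h1 h2.
move: (h1 (lexx _)) (h2 (lexx _)).
rewrite /chi2_density (correlation_upd g u v r e (r e)) (evidence_upd g r e (r e)).
rewrite (correlation_upd g u v r e (- r e)) (evidence_upd g r e (- r e)).
rewrite (correlation_upd g u v r e (-1)) (evidence_upd g r e (-1)).
set a := correlation _ _ _ (upd r e 0); set d := evidence _ (upd r e 0).
set c1 := correlation _ _ _ (upd r e 1); set b1 := evidence _ (upd r e 1).
move=> H1 H2.
have := @linear_fractional_chord a (b1 - d) (c1 - a) d (r e).
rewrite !mulNr !mul1r.
have -> : a + (c1 - a) = c1 by ring.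
have -> : d + (b1 - d) = b1 by ring.
by apply => //; move: H2; rewrite !mulNr !mul1r.
Qed.

Lemma open_probU1 S (gam : edge n -> R) o e : e \notin S -> o \subset S ->
  open_prob (e |: S) gam o = (1 - gam e) * open_prob S gam o /\
  open_prob (e |: S) gam (e |: o) = gam e * open_prob S gam o.
Proof.
move=> eS oS; have eo : e \notin o by apply: contra eS => /(fintype.subsetP oS).
rewrite /open_prob; split.
  have -> : (e |: S) :\: o = e |: (S :\: o).
    apply/setP => j; rewrite !inE.
    by have [->|//] := eqVneq j e; rewrite eo.
  by rewrite [X in _ * X = _]big_setU1/= ?inE ?(negbTE eS) ?andbF// mulrCA.
have -> : (e |: S) :\: (e |: o) = S :\: o.
  apply/setP => j; rewrite !inE.
  by have [->|//] := eqVneq j e; rewrite (negbTE eS) andbF.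
by rewrite [X in X * _ = _]big_setU1//= mulrA.
Qed.

(** One factor per edge of [g] is the form that can be integrated over independent edge outputs. *)
Lemma open_probE g (gam : edge n -> R) o : o \subset g ->
  open_prob g gam o = \prod_(e in g) (if e \in o then gam e else 1 - gam e).
Proof.
move=> og; rewrite [RHS](big_setID o)/= (finset.setIidPr og).
congr (_ * _); apply: eq_bigr => e; first by move=> ->.
by rewrite finset.inE => /andP[/negbTE ->].
Qed.

(** Serves on vertices, to reverse the spins of a set, and on edges, to reverse the sign of a
    statistic. *)
Definition flip (I : finType) (A : pred I) (z : {ffun I -> spin}) :
  {ffun I -> spin} := [ffun i => z i (+) A i].

Lemma flipK (I : finType) (A : pred I) : involutive (flip A).
Proof. by move=> z; apply/ffunP => i; rewrite !ffunE -addbA addbb addbF. Qed.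

Lemma avg_flip (I : finType) (A : pred I) (f : {ffun I -> spin} -> R) :
  avg (fun z => f (flip A z)) = avg f.
Proof. by rewrite -(avg_inv f (flipK A)). Qed.

(* Replaces the edges of S, one at a time, by erasure channels: [o] is the set
   of edges of S that are not erased. *)
Lemma chi2_density_erasure g u v r S : (forall e, `|r e| <= 1) ->
  avg (fun s => chi2_density g u v (fun e => sgn (s e) * r e)) <=
  \sum_(o : graph n | o \subset S) open_prob S (fun e => r e ^+ 2) o *
    avg (fun s => chi2_density g u v
      (fun e => sgn (s e) * (if e \in S then (e \in o)%:R else r e))).
Proof.
move=> r1; pose K S' := \sum_(o : graph n | o \subset S')
    open_prob S' (fun e => r e ^+ 2) o *
    avg (fun s => chi2_density g u v
      (fun e => sgn (s e) * (if e \in S' then (e \in o)%:R else r e))).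
rewrite -/(K S).
have [k] := ubnP #|S|; elim: k => // k IH in S *; rewrite ltnS => Sk.
have [->|[e eS]] := set_0Vmem S.
  rewrite /K (eq_bigl (pred1 finset.set0)); last by move=> o; rewrite finset.subset0.
  rewrite big_pred1_eq /open_prob finset.setD0 !big_set0 !mul1r.
  apply: le_avg => s; rewrite le_eqVlt; apply/orP; left; apply/eqP.
  by apply: eq_chi2_density => e _; rewrite inE.
have eS' : e \notin S :\ e by rewrite !inE eqxx.
apply: (le_trans (IH (S :\ e) _)).
  by apply: leq_trans Sk; rewrite [ltnRHS](cardsD1 e) eS add1n.
rewrite -{2}(finset.setD1K eS); set S' := S :\ e in eS' *.
rewrite /K sum_subset_setU1//; apply: ler_sum => o oS'.
have [-> ->] := open_probU1 (fun e => r e ^+ 2) eS' oS'.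
have eo : e \notin o by apply: contra eS' => /(fintype.subsetP oS').
have pr0 : 0 <= open_prob S' (fun e => r e ^+ 2) o.
  apply: mulr_ge0; apply: prodr_ge0 => i _; rewrite ?sqr_ge0// subr_ge0.
  by rewrite -real_normK ?num_real// expr_le1.
move: (open_prob _ _ _) pr0 => w w0.
rewrite ![_ * w]mulrC -!(mulrA w) -mulrDr; apply: ler_wpM2l => //.
(* The signed statistics once the edges of [S'] are replaced; [e] still has its original
   magnitude. *)
pose p s := fun e => sgn (s e) * (if e \in S' then (e \in o)%:R else r e).
have p1 s e' : `|p s e'| <= 1.
  rewrite /p normrM normr_sgn mul1r; case: ifP => // _.
  by case: (_ \in _); rewrite ?normr1 ?normr0.
have pflip s e' : p (flip (pred1 e) s) e' = upd (p s) e (- p s e) e'.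
  rewrite /p /upd ffunE/=; have [->|_] := eqVneq e' e; last by rewrite addbF.
  by rewrite addbT sgnN mulNr.
(* Which of [s] and its flip at [e] takes the end 1 of the chord depends on [s e]; the chord bound
   is symmetric in the two ends. *)
have sgn_or s : (sgn (s e) = 1 /\ sgn (~~ s e) = -1) \/
    (sgn (s e) = -1 /\ sgn (~~ s e) = 1).
  by case: (s e); [left|right].
(* Each sign pattern is paired with its flip at [e], since the chord bound holds only for the sum
   over both signs. *)
have half (f : {ffun edge n -> spin} -> R) :
    avg f = avg (fun s => (f s + f (flip (pred1 e) s)) / 2).
  rewrite [RHS](eq_avg (fun s => mulrC _ _)).
  by rewrite avgZ avgD avg_flip; field.
rewrite [leLHS]half [X in _ <= _ + _ * X]half -!avgZ -avgD; apply: le_avg => s.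
rewrite (@eq_chi2_density _ _ _ (fun e' => sgn (flip _ _ e') * _)
   (upd (p s) e (- p s e))); last by move=> e' _; exact: pflip.
have := chi2_density_chord g u v e (p1 s).
have -> : p s e ^+ 2 = r e ^+ 2.
  by rewrite /p (negbTE eS') exprMn sqr_sgn mul1r.
have E0 : chi2_density g u v (upd (p s) e 0) =
  chi2_density g u v (fun e' => sgn (s e') *
     (if e' \in e |: S' then (e' \in o)%:R else r e')).
  apply: eq_chi2_density => e' _; rewrite /upd /p !inE.
  by have [->|_] := eqVneq e' e; rewrite /= ?(negbTE eo) ?mulr0.
have E1 s' : s' = s \/ s' = flip (pred1 e) s ->
  chi2_density g u v (upd (p s) e (sgn (s' e))) =
  chi2_density g u v (fun e' => sgn (s' e') *
     (if e' \in e |: S' then (e' \in e |: o)%:R else r e')).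
  move=> s's; apply: eq_chi2_density => e' _; rewrite /upd /p !inE.
  have [->|e'e] := eqVneq e' e; rewrite /= ?mulr1//.
  suff -> : s' e' = s e' by [].
  by case: s's => -> //; rewrite ffunE/= (negbTE e'e) addbF.
have F1 := E1 s (or_introl erefl).
have F2 := E1 _ (or_intror erefl).
rewrite -E0 -F1 -F2 ffunE/= eqxx addbT.
set X := chi2_density g u v (p s).
change (chi2_density g u v (fun e0 => sgn (s e0) *
  (if e0 \in S' then (e0 \in o)%:R else r e0))) with X.
case: (sgn_or s) => [[-> ->]|[-> ->]]; lra.
Qed.

Lemma adj_connect_src_tgt (o : graph n) e u :
  e \in o -> connect (adj o) u (src e) = connect (adj o) u (tgt e).
Proof.
move=> eo.
have a1 : adj o (src e) (tgt e).
  by apply/existsP; exists e; rewrite eo !eqxx.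
have a2 : adj o (tgt e) (src e).
  by apply/existsP; exists e; rewrite eo !eqxx orbT.
apply/idP/idP => h; first exact: connect_trans h (connect1 a1).
exact: connect_trans h (connect1 a2).
Qed.

(** Flipping the component of [u] reverses [x_u x_v] and preserves the weight: an edge of [o] has
    both endpoints in the component or neither, and any other edge of [g] has statistic 0. *)
Lemma correlation_disconnected g u v r o : ~~ connect (adj o) u v ->
  {in g, forall e, e \notin o -> r e = 0} -> correlation g u v r = 0.
Proof.
move=> uv r0.
suff : correlation g u v r = - correlation g u v r by lra.
rewrite {1}/correlation -(avg_flip (connect (adj o) u)) -avgN.
apply: eq_avg => x; rewrite -mulNr; congr (_ * _).
  rewrite !ffunE /= connect0 (negbTE uv) addbF addbT !sgnM sgnN; ring.
apply: eq_bigr => e eg; have [eo|eo] := boolP (e \in o); last first.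
  by rewrite r0// !mulr0.
rewrite !ffunE -(adj_connect_src_tgt u eo) /spin_mul.
by case: (x _) (x _) (connect _ _ _) => [] [] [].
Qed.

Lemma weight_flip g r x : weight g r (flip xpredT x) = weight g r x.
Proof.
apply: eq_bigr => e _; rewrite !ffunE !addbT /spin_mul.
by case: (x _) (x _) => [] [].
Qed.

(** The unnormalized posterior law of [(x_u, x_v)]. Under the global flip its odd part cancels, so
    the marginals are uniform and only the correlation remains. *)
Lemma avg_weight_pair g u v r (z : spin * spin) :
  avg (fun x => ((x u == z.1) && (x v == z.2))%:R * weight g r x) =
  4^-1 * (evidence g r + sgn (spin_mul z.1 z.2) * correlation g u v r).
Proof.
set f := fun x => _.
(* After symmetrization under the global flip the identity holds for each [x] separately. *)
have -> : avg f = 2^-1 * (avg f + avg f) by field.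
rewrite -{2}(avg_flip xpredT f) -avgD /evidence /correlation -avgZ -avgD -!avgZ.
apply: eq_avg => x; rewrite /f weight_flip !ffunE !addbT -mulrDl /spin_mul.
by case: (z) => [[] []]; case: (x u) (x v) => [] []; rewrite /sgn/=; field.
Qed.

(** For fixed [x], each edge factor averages to 1 over its own sign, and the signs are
    independent. *)
Lemma avg_evidence g (c : edge n -> R) :
  avg (fun s => evidence g (fun e => sgn (s e) * c e)) = 1.
Proof.
rewrite /evidence exchange_avg.
under eq_avg => x.
  rewrite /weight.
  rewrite (avg_prod g (fun e b => 1 +
     sgn (spin_mul (x (src e)) (x (tgt e))) * (sgn b * c e))) big1; last first.
    by move=> e _; rewrite /sgn; field.
  over.
by rewrite (avg_cst ([ffun=> true] : {ffun 'I_n -> spin})).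
Qed.

(** With every edge of [g] erased or noiseless, a configuration that connects [u] and [v]
    contributes at most the mean evidence, which is 1, and any other contributes 0. *)
Lemma avg_chi2_density_le g u v r : (forall e, `|r e| <= 1) ->
  avg (fun s => chi2_density g u v (fun e => sgn (s e) * r e)) <=
  conn_prob g (fun e => r e ^+ 2) u v.
Proof.
move=> r1; apply: le_trans (chi2_density_erasure g u v g r1) _.
rewrite [leRHS]/conn_prob [leRHS]big_mkcondr/=; apply: ler_sum => o og.
have pr0 : 0 <= open_prob g (fun e => r e ^+ 2) o.
  apply: mulr_ge0; apply: prodr_ge0 => i _; rewrite ?sqr_ge0// subr_ge0.
  by rewrite -real_normK ?num_real// expr_le1.
case: ifPn => uv.
  rewrite -[leRHS]mulr1; apply: ler_wpM2l => //.
  rewrite -[leRHS](avg_evidence g (fun e => if e \in g then (e \in o)%:R else r e)).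
  apply: le_avg => s; apply: chi2_density_le => e _.
  rewrite normrM normr_sgn mul1r; case: ifP => // _.
  by case: (_ \in _); rewrite ?normr1 ?normr0.
rewrite (_ : avg _ = 0) ?mulr0//.
rewrite -[RHS](avg_cst ([ffun=> true] : {ffun edge n -> spin})).
apply: eq_avg => s; rewrite /chi2_density.
rewrite (correlation_disconnected uv) ?expr0n ?mul0r//.
by move=> e eg /negbTE ->; rewrite eg mulr0.
Qed.

End spin_posterior.

Local Open Scope classical_set_scope.
Local Open Scope charge_scope.

(** * Integration *)

Section weighted_pushforward.
Local Open Scope ereal_scope.
Context (d1 d2 : measure_display) (T1 : measurableType d1)
  (T2 : measurableType d2) (R : realType).
Variables (mu : {measure set T1 -> \bar R}) (D : set T1) (I : finType).
Variables (w : I -> T1 -> R) (f : I -> T1 -> T2).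
Hypotheses (mD : measurable D) (mw : forall i, measurable_fun setT (w i)).
Hypotheses (mf : forall i, measurable_fun setT (f i)).
Hypotheses (w0 : forall i x, (0 <= w i x)%R).

Let mpre i B : measurable B -> measurable (f i @^-1` B).
Proof. by move=> mB; rewrite -[X in measurable X]setTI; exact: mf. Qed.

Let mterm i B : measurable B ->
  measurable_fun setT (fun x => (w i x * \1_B (f i x))%:E).
Proof.
move=> mB; apply/measurable_EFinP; apply: measurable_funM => //.
by apply: measurableT_comp => //; exact: measurable_indic.
Qed.

Let term_ge0 i (B : set T2) x : 0 <= (w i x * \1_B (f i x))%:E.
Proof. by rewrite lee_fin mulr_ge0. Qed.

Lemma weighted_pushforwardE B : measurable B ->
  \int[mu]_(x in D) \sum_i (w i x * \1_B (f i x))%:E =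
  \sum_i \int[mu]_(x in D `&` f i @^-1` B) (w i x)%:E.
Proof.
move=> mB; rewrite ge0_integral_sum//; last first.
  by move=> i; apply: measurable_funTS; exact: mterm.
apply: eq_bigr => i _; rewrite [RHS]integral_mkcondr; apply: eq_integral => x _.
rewrite patchE indicE; have -> : (x \in f i @^-1` B) = (f i x \in B).
  by apply/idP/idP; rewrite !inE.
by case: (_ \in _); rewrite ?mulr1 ?mulr0.
Qed.

(** The measure is the sum over [i] of the image under [f i] of [mu] on [D] with density [w i]. In
    the main use, [i] is a sign pattern, [f i] applies the corresponding involutions to the output,
    and [w i] is the reweighting. *)
Lemma weighted_pushforward_measure :
  exists m : {measure set T2 -> \bar R}, forall B, measurable B ->
    m B = \int[mu]_(x in D) \sum_i (w i x * \1_B (f i x))%:E.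
Proof.
pose m B := \sum_i \int[mu]_(x in D `&` f i @^-1` B) (w i x)%:E.
have m0 : m set0 = 0.
  by apply: big1 => i _; rewrite preimage_set0 setI0 integral_set0.
have m_ge0 B : 0 <= m B.
  by apply: sume_ge0 => i _; apply: integral_ge0 => x _; rewrite lee_fin.
have m_sigma : semi_sigma_additive m.
  move=> F mF tF mUF.
  rewrite [X in X @ _](_ : _ = (fun k => \sum_i \sum_(0 <= j < k)
    \int[mu]_(x in D `&` f i @^-1` F j) (w i x)%:E)); last first.
    by apply/funext => k; rewrite exchange_big.
  apply: cvg_nnesum => i _.
    by near=> k; apply: sume_ge0 => j _; apply: integral_ge0 => x _; rewrite lee_fin.
  rewrite preimage_bigcup setI_bigcupr.
  apply: semi_sigma_additive_nng_induced.
  - exact/measurable_EFinP.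
  - by move=> x; rewrite lee_fin.
  - by move=> j; apply: measurableI => //; exact: mpre.
  - apply: trivIset_setIl; apply/trivIsetP => a b _ _ ab.
    by rewrite -preimage_setI (trivIsetP.1 tF)// preimage_set0.
  - by apply: bigcupT_measurable => j; apply: measurableI => //; exact: mpre.
pose mm := isMeasure.Build _ _ _ m m0 m_ge0 m_sigma.
pose M : {measure set T2 -> \bar R} := HB.pack m mm.
by exists M => B mB; rewrite weighted_pushforwardE.
Unshelve. all: by end_near. Qed.

Variable nu : {measure set T2 -> \bar R}.
Hypothesis nuE : forall B, measurable B ->
  nu B = \int[mu]_(x in D) \sum_i (w i x * \1_B (f i x))%:E.

Import HBNNSimple.

Let mtermZ i (g : T2 -> \bar R) : measurable_fun setT g ->
  measurable_fun setT (fun x => (w i x)%:E * g (f i x)).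
Proof.
move=> mg; apply: emeasurable_funM; first exact/measurable_EFinP.
exact: measurableT_comp.
Qed.

Let integral_weighted_nnsfun (h : {nnsfun T2 >-> R}) :
  \int[nu]_y (h y)%:E =
  \int[mu]_(x in D) \sum_i (w i x)%:E * (h (f i x))%:E.
Proof.
rewrite integralT_nnsfun sintegralE.
transitivity (\int[mu]_(x in D) \sum_(r \in range h)
    r%:E * \sum_i (w i x * \1_(h @^-1` [set r]) (f i x))%:E); last first.
  apply: eq_integral => x _.
  transitivity (\sum_(r \in range h)
     (\sum_i (w i x * (r * \1_(h @^-1` [set r]) (f i x))))%:E).
    apply: eq_fsbigr => r _; rewrite sumEFin -EFinM mulr_sumr; congr EFin.
    by apply: eq_bigr => i _; rewrite mulrCA.
  rewrite fsumEFin// fsbig_finite//= exchange_big/= -sumEFin.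
  apply: eq_bigr => i _; rewrite -mulr_sumr EFinM; congr (_ * _).
  by rewrite (fimfunE h (f i x)) fsbig_finite.
rewrite ge0_integral_fsum//; last 2 first.
- move=> r; apply: measurable_funTS; apply: measurable_funeM.
  by apply: emeasurable_sum => i; exact: mterm.
- move=> r x _; rewrite sumEFin -EFinM lee_fin.
  have [r0|r0] := leP 0%R r.
    by rewrite mulr_ge0// sumr_ge0// => i _; rewrite mulr_ge0.
  rewrite big1 ?mulr0// => i _; rewrite preimage_nnfun0// indic0 mulr0//.
apply: eq_fsbigr => r; rewrite inE => -[y _ <-].
rewrite nuE// ge0_integralZl//.
- by apply: measurable_funTS; apply: emeasurable_sum => i; exact: mterm.
- by move=> x _; apply: sume_ge0 => i _; rewrite lee_fin mulr_ge0.
- by rewrite lee_fin.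
Qed.

(** Change of variables, extended from indicators to simple functions and then by monotone limits.
    Only the values of [nu] on measurable sets are assumed, so it can be applied to a measure built
    in another way. *)
Lemma ge0_integral_weighted_pushforward (phi : T2 -> \bar R) :
  measurable_fun setT phi -> (forall y, 0 <= phi y) ->
  \int[nu]_y phi y = \int[mu]_(x in D) \sum_i (w i x)%:E * phi (f i x).
Proof.
move=> mphi phi0; pose h := nnsfun_approx measurableT mphi.
have hphi y : (h n y)%:E @[n --> \oo] --> phi y.
  exact: (@cvg_nnsfun_approx _ _ _ _ _ _ mphi (fun x _ => phi0 x)).
have nd_h y : nondecreasing_seq (fun n => (h n y)%:E).
  by move=> a b ab; rewrite lee_fin; exact/lefP/nd_nnsfun_approx.
transitivity (limn (fun n => \int[nu]_y (h n y)%:E)).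
  rewrite -monotone_convergence//=.
  - by apply: eq_integral => y _; apply/esym/cvg_lim.
  - by move=> n; exact/measurable_EFinP/measurable_funP.
  - by move=> n y _; rewrite lee_fin.
transitivity (limn (fun n =>
  \int[mu]_(x in D) \sum_i (w i x)%:E * (h n (f i x))%:E)).
  by under eq_fun do rewrite integral_weighted_nnsfun.
rewrite -monotone_convergence//=.
- apply: eq_integral => x _; apply/cvg_lim => //.
  apply: cvg_nnesum => i _; last by apply: cvgeZl => //; exact: hphi.
  by apply: nearW => n; rewrite mule_ge0// lee_fin.
- move=> n; apply: measurable_funTS; apply: emeasurable_sum => i.
  by apply: (@mtermZ i (EFin \o h n)); exact/measurable_EFinP/measurable_funP.
- by move=> n x _; apply: sume_ge0 => i _; rewrite mule_ge0// lee_fin.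
- move=> x _ a b ab; apply: lee_sum => i _.
  by apply: lee_wpmul2l; rewrite ?lee_fin//; exact/lefP/nd_nnsfun_approx.
Qed.

End weighted_pushforward.

Lemma restricted_law (R : realType) (d1 d2 : measure_display)
    (T1 : measurableType d1) (T2 : measurableType d2)
    (mu : {measure set T1 -> \bar R}) (D : set T1) (f : T1 -> T2) :
  measurable D -> measurable_fun setT f ->
  exists m : {measure set T2 -> \bar R},
    (forall B, measurable B -> m B = mu (D `&` f @^-1` B)) /\
    (forall phi : T2 -> \bar R, measurable_fun setT phi ->
       (forall y, 0 <= phi y)%E ->
       \int[m]_y phi y = \int[mu]_(x in D) phi (f x))%E.
Proof.
move=> mD mf.
have m1 (i : 'I_1) : measurable_fun setT ((fun=> 1) : T1 -> R) by [].
have [m mE] := @weighted_pushforward_measure _ _ _ _ R mu D 'I_1 (fun _ _ => 1)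
  (fun=> f) mD m1 (fun=> mf) (fun _ _ => ler01).
exists m; split=> [B mB|phi mphi phi0].
  rewrite mE// weighted_pushforwardE// big_ord1 integral_cst ?mul1e//.
  by apply: measurableI => //; rewrite -[X in measurable X]setTI; exact: mf.
rewrite (ge0_integral_weighted_pushforward mD m1 (fun=> mf) (fun _ _ => ler01) mE)//.
by apply: eq_integral => x _; rewrite big_ord1 mul1e.
Qed.

Section ae_equal_integral.
Local Open Scope ereal_scope.
Context (d : measure_display) (T : measurableType d) (R : realType).
Variable mu : {measure set T -> \bar R}.

Import HBNNSimple.

(** The integral of a nonnegative function is a supremum over simple functions below it. Cutting
    such a function to 0 on [N] keeps its integral and places it below [g]. *)
Let le_integral_ae (f g : T -> \bar R) (N : set T) :
  measurable N -> mu N = 0 -> (forall x, 0 <= f x) -> (forall x, 0 <= g x) ->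
  (forall x, ~ N x -> f x = g x) -> \int[mu]_x f x <= \int[mu]_x g x.
Proof.
move=> mN N0 f0 g0 fg.
rewrite !ge0_integralTE//; apply: ge_ereal_sup => _ [h hf <-].
have mNC : measurable (~` N) by exact: measurableC.
pose h' : {nnsfun T >-> R} := proj_nnsfun h mNC.
have h'E x : (h' x)%:E = ((EFin \o h) \_ (~` N)) x.
  rewrite /h' /= patchE /mindic indicE; case: (_ \in _); first by rewrite mulr1.
  by rewrite mulr0.
apply: ereal_sup_ge; exists (sintegral mu h').
  exists h' => // x; rewrite h'E patchE; case: ifPn => [xN|_]; last exact: g0.
  rewrite -fg; first exact: hf.
  by rewrite inE in xN.
rewrite -!integralT_nnsfun (ge0_negligible_integral mN)//=; last 2 first.
- by apply/measurable_EFinP; exact: measurable_funP.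
- by move=> x _; rewrite lee_fin.
rewrite setTD integral_mkcond le_eqVlt; apply/orP; left; apply/eqP.
by apply: eq_integral => x _; rewrite h'E.
Qed.

(* [ge0_ae_eq_integral] without measurability: [chi2_mi \o cond_law] need not be
   known to be measurable. *)
Lemma ge0_integral_eq_ae (f g : T -> \bar R) :
  (forall x, 0 <= f x) -> (forall x, 0 <= g x) ->
  ae_eq mu setT f g -> \int[mu]_x f x = \int[mu]_x g x.
Proof.
move=> f0 g0 [N [mN N0 fgN]].
have fg x : ~ N x -> f x = g x.
  by move=> Nx; apply: contrapT => nfg; apply: Nx; apply: fgN => /= /(_ I).
apply/eqP; rewrite eq_le; apply/andP; split.
  exact: (le_integral_ae mN N0).
by apply: (le_integral_ae mN N0) => // x /fg.
Qed.

End ae_equal_integral.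

Section as_probability.
Context (d : measure_display) (T : measurableType d) (R : realType).
Variables (m : {measure set T -> \bar R}) (m1 : m setT = 1%E).

Definition as_probability of m setT = 1%E : set T -> \bar R := m.

HB.instance Definition _ := Measure.on (as_probability m1).

HB.instance Definition _ :=
  Measure_isProbability.Build _ _ _ (as_probability m1) m1.

End as_probability.

Section finite_partition.
Local Open Scope ereal_scope.
Context (d : measure_display) (T : measurableType d) (R : realType).
Variables (mu : {measure set T -> \bar R}) (I : finType) (f : T -> I).
Hypothesis mf : forall i, measurable (f @^-1` [set i]).

Lemma ge0_integral_partition (A : set T) (g : T -> \bar R) :
  measurable A -> measurable_fun A g -> (forall x, A x -> 0 <= g x) ->
  \int[mu]_(x in A) g x = \sum_i \int[mu]_(x in A `&` f @^-1` [set i]) g x.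
Proof.
move=> mA mg g0.
under [RHS]eq_bigr => i _ do rewrite integral_mkcondr.
rewrite -ge0_integral_sum//.
- apply: eq_integral => x _; rewrite (bigD1 (f x))//= big1 ?adde0.
    by rewrite patchE ifT// inE.
  move=> i fxi; rewrite patchE ifF//; apply/negbTE.
  by rewrite notin_setE/= => ix; rewrite ix eqxx in fxi.
- move=> i; apply/measurable_restrict => //.
  exact: measurable_funS mg.
- by move=> i x Ax; rewrite patchE; case: ifP => // _; exact: g0.
Qed.

Lemma measure_partition (A : set T) : measurable A ->
  mu A = \sum_i mu (A `&` f @^-1` [set i]).
Proof.
move=> mA; rewrite -[LHS]mul1e -integral_cst// ge0_integral_partition//.
by apply: eq_bigr => i _; rewrite integral_cst ?mul1e//; exact: measurableI.
Qed.

End finite_partition.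

(** * The chi2-information of two spins *)

Section two_spins.
Context (R : realType).

Lemma measurable_spin2 (A : set (spin * spin)) : measurable A.
Proof.
have -> : A = \bigcup_(z in A) ([set z.1] `*` [set z.2]).
  apply/seteqP; split => [z Az|[a b] [[a' b'] Az [/= -> ->]]//].
  by exists z => //; case: z Az.
apply: fin_bigcup_measurable; first exact: finite_finset.
by move=> z _; apply: measurableX.
Qed.

(* The law of two spins with uniform marginals and correlation [rho]. *)
Definition spin2_mass (rho : R) (z : spin * spin) : R :=
  4^-1 * (1 + sgn R (spin_mul z.1 z.2) * rho).

Lemma spin2_mass_ge0 rho z : `|rho| <= 1 -> 0 <= spin2_mass rho z.
Proof.
rewrite ler_norml => /andP[? ?]; rewrite /spin2_mass mulr_ge0//.
by rewrite /sgn; case: ifP => _; lra.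
Qed.

(** The product of the marginals is uniform and the density is [1 + z_1 z_2 rho], so the integrand
    is the constant [rho ^+ 2]. *)
Lemma chi2_mi_spin2 (nu : probability (spin * spin)%type R) (rho : R) :
  (forall z, nu [set z] = (spin2_mass rho z)%:E) -> chi2_mi nu = (rho ^+ 2)%:E.
Proof.
move=> nuE; rewrite /chi2_mi.
set pi : probability _ _ := (_ \x _)%E.
have marg1 a : distribution nu (@fst spin spin) [set a] = (2^-1)%:E.
  rewrite /distribution/= /pushforward.
  have -> : fst @^-1` [set a] = [set (a, true)] `|` [set (a, false)].
    by apply/seteqP; split => [[x []] /= ->|[x y] /= [[-> _]|[-> _]]]; [left|right| |].
  apply: eq_trans (measureU nu (measurable_spin2 _) (measurable_spin2 _) _) _.
    by apply/seteqP; split => // z [-> ].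
  rewrite [X in (X + _)%E]nuE [X in (_ + X)%E]nuE -EFinD.
  rewrite /spin2_mass /sgn /spin_mul; congr EFin.
  by case: a => /=; lra.
have marg2 a : distribution nu (@snd spin spin) [set a] = (2^-1)%:E.
  rewrite /distribution/= /pushforward.
  have -> : snd @^-1` [set a] = [set (true, a)] `|` [set (false, a)].
    by apply/seteqP; split => [[[] y] /= ->|[x y] /= [[_ ->]|[_ ->]]]; [left|right| |].
  apply: eq_trans (measureU nu (measurable_spin2 _) (measurable_spin2 _) _) _.
    by apply/seteqP; split => // z [-> ].
  rewrite [X in (X + _)%E]nuE [X in (_ + X)%E]nuE -EFinD.
  rewrite /spin2_mass /sgn /spin_mul; congr EFin.
  by case: a => /=; lra.
have pi1 z : pi [set z] = (4^-1)%:E.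
  have -> : [set z] = [set z.1] `*` [set z.2].
    by apply/seteqP; split => [_ -> //|[x y] [/= -> ->]]; case: z.
  apply: eq_trans (product_measure1E _ _ _ _) _ => //.
  rewrite [X in (X * _)%E]marg1 [X in (_ * X)%E]marg2 -EFinM; congr EFin.
  by rewrite -invfM -natrM.
have dom : nu `<< pi.
  apply/null_content_dominatesP => A mA A0.
  suff -> : A = set0 by rewrite measure0.
  apply/seteqP; split => // z Az.
  have : (pi [set z] <= pi A)%E.
    by apply: le_measure; rewrite ?inE//; [exact: measurable_spin2|move=> _ ->].
  by rewrite A0 pi1 lee_fin leNgt invr_gt0 ltr0n.
(* Every point has positive mass under [pi], so integrating the derivative over a singleton
   determines its value there, not merely almost everywhere. *)
have rn z : ('d (charge_of_finite_measure nu) '/d pi) z =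
    (1 + sgn R (spin_mul z.1 z.2) * rho)%:E.
  have := esym (@Radon_Nikodym_integral _ _ _
    (charge_of_finite_measure nu) pi _ dom (measurable_spin2 [set z])).
  rewrite [RHS]nuE.
  have := @Radon_Nikodym_fin_num _ _ _ (charge_of_finite_measure nu) pi z dom.
  set h := Radon_Nikodym _ _ => hfin.
  rewrite (eq_integral (fun=> h z)); last by move=> z'; rewrite inE => ->.
  rewrite -(fineK hfin) integral_cst; last exact: measurable_spin2.
  rewrite [X in (_ * X)%E]pi1 -EFinM /spin2_mass => -[H].
  by congr EFin; lra.
under eq_integral => z _.
  rewrite rn -EFinB -EFin_expe addrAC subrr add0r exprMn sqr_sgn mul1r.
  over.
by rewrite integral_cst// [X in (_ * X)%E]probability_setT mule1.
Qed.

Lemma chi2_mi_ge0 (d1 d2 : measure_display) (T1 : measurableType d1)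
  (T2 : measurableType d2) (nu : probability (T1 * T2)%type R) :
  (0 <= chi2_mi nu)%E.
Proof. by apply: integral_ge0 => z _; rewrite expe2 sqre_ge0. Qed.

(** * Conditional information from a posterior correlation *)

Section cond_chi2_spin2.
Context (dO dC : measure_display) (Omega : measurableType dO)
  (TC : measurableType dC) (P : probability Omega R).
Variables (A B : {RV P >-> spin}) (C : {RV P >-> TC}) (rho : TC -> R).
Hypotheses (mrho : measurable_fun setT rho) (rho1 : forall y, `|rho y| <= 1).
Hypothesis joint : forall (z : spin * spin) (D : set TC), measurable D ->
  P ([set w | A w = z.1 /\ B w = z.2] `&` C @^-1` D) =
  (\int[P]_(w in C @^-1` D) (spin2_mass (rho (C w)) z)%:E)%E.

Let mspin2_mass z : measurable_fun setT (fun y => spin2_mass (rho y) z).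
Proof.
apply: measurable_funM => //; apply: measurable_funD => //.
exact: measurable_funM.
Qed.

Let mC D : measurable D -> measurable (C @^-1` D).
Proof. by move=> mD; rewrite -[X in measurable X]setTI; exact: measurable_funP. Qed.

Let kappa_exists y : exists k : probability (spin * spin)%type R,
  forall S, k S = (\sum_z (spin2_mass (rho y) z * \1_S z)%:E)%E.
Proof.
(* The maps and weights are constant in the sample point: [P] only supplies a total mass of 1, and
   point [z] receives mass [spin2_mass (rho y) z]. *)
have [m mE] := @weighted_pushforward_measure _ _ Omega (spin * spin)%type R P setT
  _ (fun z _ => spin2_mass (rho y) z) (fun z _ => z) measurableT
  (fun z => @measurable_cst _ _ _ _ _ _) (fun z => @measurable_cst _ _ _ _ _ _)
  (fun z _ => spin2_mass_ge0 z (rho1 y)).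
have mS S : m S = (\sum_z (spin2_mass (rho y) z * \1_S z)%:E)%E.
  rewrite mE; last exact: measurable_spin2.
  rewrite (eq_integral (fun=> (\sum_z (spin2_mass (rho y) z * \1_S z))%:E)).
    by rewrite integral_cst// [X in (_ * X)%E]probability_setT mule1 sumEFin.
  by move=> x _; rewrite sumEFin.
have m1 : m setT = 1%E.
  rewrite mS sumEFin -(pair_bigA _ (fun a b => spin2_mass (rho y) (a, b) *
    \1_setT (a, b)))/= !big_bool/= !indicT/spin2_mass/spin_mul/sgn/=; congr EFin; lra.
by exists (as_probability m1).
Qed.

(** The choice made by [cond_law] is meaningful because the kernel with correlation [rho] is a
    conditional law. *)
Let kappaP : is_cond_law P (fun w => (A w, B w)) C
  (cond_law P (fun w => (A w, B w)) C).
Proof.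
apply: getPex.
have [k kE] := choice kappa_exists.
exists k; split.
  move=> S _; under eq_fun do rewrite kE sumEFin.
  apply/measurable_EFinP; apply: measurable_sum => z.
  exact: measurable_funM.
move=> S D mS mD.
have mZ z : measurable ((fun w => (A w, B w)) @^-1` [set z]).
  rewrite (_ : _ @^-1` _ = A @^-1` [set z.1] `&` B @^-1` [set z.2]).
    by apply: measurableI; rewrite -[X in measurable X]setTI; exact: measurable_funP.
  by apply/seteqP; split => w /=; case: z => a b /= [-> ->].
have mZS : measurable ((fun w => (A w, B w)) @^-1` S).
  rewrite (_ : _ @^-1` _ = \bigcup_(z in S) (fun w => (A w, B w)) @^-1` [set z]).
    by apply: fin_bigcup_measurable => //; exact: finite_finset.
  rewrite -preimage_bigcup; congr (_ @^-1` _).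
  by apply/seteqP; split => [z Sz|z [z' Sz' ->]//]; exists z.
rewrite (measure_partition P mZ); last by apply: measurableI => //; exact: mC.
under [RHS]eq_integral do rewrite kE.
rewrite ge0_integral_sum//.
- apply: eq_bigr => z _; rewrite indicE; have [Sz|Sz] := boolP (z \in S).
    under eq_integral do rewrite mulr1.
    rewrite -joint//; congr (P _); apply/seteqP; split => w /=.
      by case: z Sz => a b /= _ [[_ Dw] [-> ->]].
    case: z Sz => a b /= Sz [[-> ->] Dw]; split => //; split => //.
    by rewrite inE in Sz.
  under eq_integral do rewrite mulr0.
  rewrite integral0 -[RHS](measure0 P); congr (P _).
  by apply/seteqP; split => // w /= [[Sw _] wz]; move: Sz; rewrite notin_setE -wz.
- exact: mC.
- move=> z; apply/measurable_EFinP; apply: measurable_funM => //.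
  by apply: measurable_funTS; apply: (measurableT_comp (mspin2_mass z)).
- by move=> z w _; rewrite lee_fin mulr_ge0// spin2_mass_ge0.
Qed.

(** The chosen conditional law and the kernel of correlation [rho] have equal integrals over every
    event of [C]. They therefore agree almost surely on the four singletons, and the information at
    [y] is [rho y ^+ 2]. *)
Lemma cond_chi2_mi_spin2 :
  cond_chi2_mi P A B C = (\int[P]_w (rho (C w) ^+ 2)%:E)%E.
Proof.
have [mk kE] := kappaP; rewrite /cond_chi2_mi.
move: (cond_law _ _ _) mk kE => k mk kE.
apply: ge0_integral_eq_ae.
- by move=> w; exact: chi2_mi_ge0.
- by move=> w; rewrite lee_fin sqr_ge0.
have kz z : ae_eq (distribution P C) setT (fun y => k y [set z])
    (fun y => (spin2_mass (rho y) z)%:E).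
  apply: integral_ae_eq => //.
  - apply/integrableP; split; first by apply: mk; exact: measurable_spin2.
    apply: (@le_lt_trans _ _ (\int[distribution P C]_y (cst 1 y)))%E.
      apply: ge0_le_integral => //.
      + apply: measurableT_comp => //; apply: mk; exact: measurable_spin2.
      + by move=> y _; rewrite gee0_abs// probability_le1//; exact: measurable_spin2.
    by rewrite integral_cst// mul1e [ltLHS]probability_setT ltry.
  - exact/measurable_EFinP.
  move=> E _ mE.
  rewrite !ge0_integral_pushforward//.
  - rewrite -kE//=; last exact: measurable_spin2.
    rewrite -joint//; congr (P (_ `&` _)); apply/seteqP; split => w /=.
      by case: z => a b [].
    by case: z => a b [-> ->].
  - by apply/measurable_EFinP; exact: measurable_funTS.
  - by move=> y _; rewrite lee_fin spin2_mass_ge0.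
  - by apply: measurable_funTS; apply: mk; exact: measurable_spin2.
have : {ae distribution P C, forall y, chi2_mi (k y) = (rho y ^+ 2)%:E}.
  have : {ae distribution P C, forall y z, k y [set z] = (spin2_mass (rho y) z)%:E}.
    by apply: filter_forall => z; move: (kz z); apply: filterS => y; exact.
  by apply: filterS => y; exact: chi2_mi_spin2.
move=> [N [mN N0 sub]]; exists (C @^-1` N); split => //; first exact: mC.
by move=> w /= nw; apply: sub => /= H; apply: nw => _.
Qed.

End cond_chi2_spin2.
End two_spins.

(** * Edge channels *)

Section symmetric_edge.
Context (R : realType) (dY : measure_display) (Y : measurableType dY).
Variable Q : spin -> probability Y R.

Definition edge_output_law : probability Y R :=
  distribution (edge_law Q) (@snd (spin * spin)%type Y).

Lemma edge_output_lawE A : measurable A ->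
  edge_output_law A = (2^-1 * (fine (Q true A) + fine (Q false A)))%:E.
Proof.
move=> mA; rewrite /edge_output_law/= /distribution/= /pushforward/= /edge_law.
rewrite (eq_bigr (fun s : spin * spin =>
  (4^-1 * fine (Q (spin_mul s.1 s.2) A))%:E)); last first.
  move=> s _; rewrite EFinM fineK ?fin_num_measure//; congr (_ * Q _ _)%E.
  by apply/seteqP; split => y; rewrite /xsection/= inE.
rewrite sumEFin; congr EFin; rewrite -(pair_bigA _ (fun a b =>
  4^-1 * fine (Q (spin_mul a b) A)))/= !big_bool/= /spin_mul/=.
lra.
Qed.

Variable T : Y -> Y.
Hypotheses (mT : measurable_fun setT T) (TK : involutive T).
Hypothesis QT : forall A, measurable A -> Q true A = Q false (T @` A).

Let imT A : T @` A = T @^-1` A.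
Proof.
apply/seteqP; split => [_ [y Ay <-]|y Ay] /=; first by rewrite TK.
by exists (T y) => //; rewrite TK.
Qed.

Let mpreT A : measurable A -> measurable (T @^-1` A).
Proof. by move=> mA; rewrite -[X in measurable X]setTI; exact: mT. Qed.

Lemma symmetric_preimage b A : measurable A -> Q b (T @^-1` A) = Q (~~ b) A.
Proof.
move=> mA; case: b; last by rewrite QT// imT.
rewrite QT; last exact: mpreT.
by rewrite imT; congr (Q _ _); apply/seteqP; split => y /=; rewrite TK.
Qed.

(** The spin [true] is the sign +1, hence the identity; the sign -1 applies the involution. *)
Definition flip_output (b : spin) : Y -> Y := if b then idfun else T.

Lemma measurable_flip_output b : measurable_fun setT (flip_output b).
Proof. by case: b; [exact: measurable_id|exact: mT]. Qed.

Lemma integral_edge_output_law (phi : Y -> \bar R) :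
  measurable_fun setT phi -> (forall y, 0 <= phi y)%E ->
  (\int[edge_output_law]_y phi y =
   \int[Q true]_y \sum_(b : spin) (2^-1)%:E * phi (flip_output b y))%E.
Proof.
move=> mphi phi0.
apply: (@ge0_integral_weighted_pushforward _ _ _ _ _ _ _ _
  (fun _ _ => 2^-1) flip_output) => //.
  exact: measurable_flip_output.
move=> B mB; rewrite ge0_integral_sum//; last first.
  move=> b; apply/measurable_EFinP; apply: measurable_funM => //.
  apply: measurableT_comp; last exact: measurable_flip_output.
  exact: measurable_indic.
have mfB b : measurable (flip_output b @^-1` B) by case: b => //; exact: mpreT.
have E b : (\int[Q true]_x (2^-1 * \1_B (flip_output b x))%:E =
    (2^-1)%:E * Q true (flip_output b @^-1` B))%E.
  under eq_integral do rewrite EFinM.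
  rewrite ge0_integralZl//.
  - rewrite (eq_integral (fun x => (\1_(flip_output b @^-1` B) x)%:E)).
      by rewrite integral_indic// setIT.
    by move=> x _; rewrite !indicE; congr (_ %:R%:E); apply/idP/idP; rewrite !inE.
  - apply/measurable_EFinP; apply: measurableT_comp; last exact: measurable_flip_output.
    exact: measurable_indic.
apply: eq_trans (edge_output_lawE mB) _.
rewrite big_bool !E [flip_output true @^-1` B](_ : _ = B)//=.
by rewrite symmetric_preimage// mulrDr EFinD !EFinM !fineK ?fin_num_measure.
Qed.

Local Notation mu := edge_output_law.

Let edge_law_preT A : measurable A -> mu (T @^-1` A) = mu A.
Proof.
move=> mA; rewrite !edge_output_lawE//; last exact: mpreT.
by rewrite !symmetric_preimage//= addrC.
Qed.

(** Twice the average dominates either channel law; this is the origin of the cut-off at 2. *)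
Let Q_le b A : measurable A -> (Q b A <= 2%:E * mu A)%E.
Proof.
move=> mA; rewrite edge_output_lawE// -EFinM mulrA divff// mul1r.
rewrite -[X in (X <= _)%E]fineK ?fin_num_measure// lee_fin.
by case: b; rewrite ?lerDl ?lerDr fine_ge0.
Qed.

Let Q_dom : Q true `<< mu.
Proof.
apply/null_content_dominatesP => A mA A0; apply/eqP; rewrite eq_le measure_ge0 andbT.
by apply: le_trans (Q_le _ mA) _; rewrite A0 mule0.
Qed.

(* The density of Q(. | +1) is cut off at its almost sure bound 2. *)
Let g y : R := Num.min (fine (Radon_Nikodym_SigmaFinite.f (Q true) mu y)) 2.

Let f_fin y : Radon_Nikodym_SigmaFinite.f (Q true) mu y \is a fin_num.
Proof. exact: Radon_Nikodym_SigmaFinite.f_fin_num. Qed.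

Let f_ge0 y : (0 <= Radon_Nikodym_SigmaFinite.f (Q true) mu y)%E.
Proof. exact: Radon_Nikodym_SigmaFinite.f_ge0. Qed.

Let mf : measurable_fun setT (Radon_Nikodym_SigmaFinite.f (Q true) mu).
Proof.
by apply: measurable_int; exact: Radon_Nikodym_SigmaFinite.f_integrable.
Qed.

Let mg : measurable_fun setT g.
Proof.
apply: measurable_minr => //.
by apply: measurableT_comp => //; exact: measurable_fine.
Qed.

Let g_ge0 y : 0 <= g y.
Proof. by rewrite /g le_min fine_ge0/=. Qed.

Let g_le2 y : g y <= 2.
Proof. by rewrite /g ge_min lexx orbT. Qed.

(** The cut-off loses no mass: on a set where the density exceeds 2, [Q true] is at most [2 mu],
    which is the integral of [g] there. *)
Let int_g A : measurable A -> (\int[mu]_(y in A) (g y)%:E = Q true A)%E.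
Proof.
move=> mA; apply/eqP; rewrite eq_le; apply/andP; split.
  rewrite (Radon_Nikodym_SigmaFinite.f_integral Q_dom mA).
  apply: ge0_le_integral => //.
  - by move=> y _; rewrite lee_fin.
  - by apply/measurable_EFinP; exact: measurable_funTS.
  - exact: measurable_funTS.
  - by move=> y _; rewrite -[leRHS]fineK// lee_fin /g ge_min lexx.
pose B := [set y | (2%:E < Radon_Nikodym_SigmaFinite.f (Q true) mu y)%E].
have mB : measurable B.
  by rewrite -[B]setTI; apply: emeasurable_fun_o_infty.
rewrite -[in leLHS](setUIDK A B) -[in leRHS](setUIDK A B).
have mAB := measurableI _ _ mA mB.
have mADB : measurable (A `\` B) by exact: measurableD.
rewrite measureU//; last by rewrite setDE setIACA setICr setI0.
rewrite ge0_integral_setU//; last 3 first.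
- by apply/measurable_EFinP; exact: measurable_funTS.
- by move=> y _; rewrite lee_fin.
- by apply/disj_set2P; rewrite setDE setIACA setICr setI0.
apply: leeD.
  rewrite (eq_integral (fun=> 2%:E)); first by rewrite integral_cst//; exact: Q_le.
  move=> y; rewrite inE => -[_ By]; congr EFin; rewrite /g; apply/min_idPr.
  by move: By; rewrite /B/= -{1}[X in (_ < X)%E]fineK// lte_fin => /ltW.
rewrite [leLHS](Radon_Nikodym_SigmaFinite.f_integral Q_dom mADB).
apply: ge0_le_integral => //.
- exact: measurable_funTS.
- by apply/measurable_EFinP; exact: measurable_funTS.
- move=> y [_ /negP]; rewrite -leNgt => f2.
  rewrite -[leLHS]fineK// lee_fin /g le_min lexx/=.
  by rewrite -lee_fin fineK.
Qed.

Let int_gT A : measurable A -> (\int[mu]_(y in A) (g (T y))%:E = Q false A)%E.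
Proof.
move=> mA; rewrite -(symmetric_preimage true)// -int_g; last exact: mpreT.
have TA : T @^-1` (T @^-1` A) = A by apply/seteqP; split => y /=; rewrite TK.
rewrite -[in LHS]TA.
have := @ge0_integral_pushforward _ _ _ _ _ _ mT mu (T @^-1` A) (EFin \o g).
move=> <-; last 3 first.
- exact: mpreT.
- by apply/measurable_EFinP; exact: measurable_funTS.
- by move=> y _; rewrite lee_fin.
apply: eq_measure_integral => B mB _.
exact: edge_law_preT.
Qed.

Lemma symmetric_edge_density : exists r : Y -> R,
  [/\ measurable_fun setT r, forall y, `|r y| <= 1,
      forall y, r (T y) = - r y &
      forall b A, measurable A ->
        (Q b A = \int[edge_output_law]_(y in A) (1 + sgn R b * r y)%:E)%E].
Proof.
(* Almost everywhere this is [g - 1], as [g] and [g \o T] average to 1. The antisymmetric form makes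
   the oddness and the bound 1 hold at every point. *)
pose r y := 2^-1 * (g y - g (T y)).
have mr : measurable_fun setT r.
  apply: measurable_funM => //; apply: measurable_funB => //.
  exact: measurableT_comp.
have r1 y : `|r y| <= 1.
  rewrite /r ler_norml.
  have := g_ge0 y; have := g_ge0 (T y); have := g_le2 y; have := g_le2 (T y).
  by move=> *; apply/andP; split; lra.
exists r; split => //.
  by move=> y; rewrite /r TK; lra.
move=> b A mA.
have r1' y : 0 <= 1 + sgn R b * r y.
  have := r1 y; rewrite ler_norml => /andP[] *.
  by case: b; rewrite /sgn; lra.
have m1 : measurable_fun setT (fun y => 1 + sgn R b * r y).
  by apply: measurable_funD => //; exact: measurable_funM.
have mgT : measurable_fun setT (g \o T) by exact: measurableT_comp.
(* The negative part of [r] is moved to the other side, so that only nonnegative functions are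
   integrated. The remaining integrals are halves of [Q b] and [Q (~~ b)], and the claim follows
   from [mu] being their average. *)
have H : (\int[mu]_(y in A) (1 + sgn R b * r y)%:E +
    \int[mu]_(y in A) (2^-1 * g (if b then T y else y))%:E =
    \int[mu]_(y in A) 1%:E + \int[mu]_(y in A) (2^-1 * g (if b then y else T y))%:E)%E.
  rewrite -!ge0_integralD//.
  - apply: eq_integral => y _; rewrite -!EFinD /r; congr EFin.
    by case: (b) => //; rewrite /sgn; lra.
  - by move=> y _; rewrite lee_fin mulr_ge0.
  - apply/measurable_EFinP; apply: measurable_funM => //; apply: measurable_funTS.
    by case: (b).
  - by move=> y _; rewrite lee_fin.
  - by apply/measurable_EFinP; exact: measurable_funTS.
  - by move=> y _; rewrite lee_fin mulr_ge0.
  - apply/measurable_EFinP; apply: measurable_funM => //; apply: measurable_funTS.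
    by case: (b).
have E c : (\int[mu]_(y in A) (2^-1 * g (if c then y else T y))%:E =
    (2^-1)%:E * Q c A)%E.
  under eq_integral do rewrite EFinM.
  rewrite ge0_integralZl//.
  - by case: c; rewrite ?int_g ?int_gT.
  - by apply/measurable_EFinP; apply: measurable_funTS; case: c.
  - by move=> y _; rewrite lee_fin.
have E' : (\int[mu]_(y in A) (2^-1 * g (if b then T y else y))%:E =
    (2^-1)%:E * Q (~~ b) A)%E.
  by rewrite -E; apply: eq_integral => y _; case: (b).
move: H; rewrite E E' integral_cst// mul1e.
rewrite [X in _ = (X + _)%E -> _](edge_output_lawE mA).
have [q qE] : exists q, forall c, Q c A = (q c)%:E.
  by exists (fun c => fine (Q c A)) => c; rewrite fineK// fin_num_measure.
rewrite !qE -!EFinM -EFinD /=.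
case: (\int[_]_(_ in _) _)%E => [z| |] //=; rewrite -?EFinD => -[].
by case: (b) => /= *; congr EFin; lra.
Qed.

End symmetric_edge.

Section edge_statistic.
Context (R : realType) (dY : measure_display) (Y : measurableType dY).
Variable Q : spin -> probability Y R.

(** Given the edge output [y], the two spins have uniform marginals and correlation [r y]. *)
Lemma edge_chi2_miE (r : Y -> R) : measurable_fun setT r ->
  (forall y, `|r y| <= 1) ->
  (forall b A, measurable A ->
     Q b A = \int[edge_output_law Q]_(y in A) (1 + sgn R b * r y)%:E)%E ->
  edge_chi2_mi Q = (\int[edge_output_law Q]_y (r y ^+ 2)%:E)%E.
Proof.
move=> mr r1 Qr; rewrite /edge_chi2_mi.
rewrite (cond_chi2_mi_spin2 (rho := r))//; last first.
  move=> z D mD.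
  transitivity ((4^-1)%:E * Q (spin_mul z.1 z.2) D)%E.
    rewrite -[LHS]/(edge_law Q _) /edge_law (bigD1 z)//= big1 ?adde0.
      congr (_ * Q _ _)%E; apply/seteqP; split => y; rewrite /xsection/= inE/=.
        by case.
      by [].
    move=> s sz; rewrite [X in Q _ X](_ : _ = set0) ?measure0 ?mule0//.
    apply/seteqP; split => // y; rewrite /xsection/= inE/= => -[[s1 s2] _].
    by move: sz; rewrite [s]surjective_pairing s1 s2 -surjective_pairing eqxx.
  rewrite Qr// -ge0_integralZl//.
  - rewrite (_ : (\int[edge_law Q]_(w in _) _)%E =
      (\int[edge_output_law Q]_(y in D) (spin2_mass (r y) z)%:E)%E) //.
    rewrite [RHS]ge0_integral_pushforward//.
    + apply/measurable_EFinP; apply: measurable_funTS; apply: measurable_funM => //.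
      by apply: measurable_funD => //; exact: measurable_funM.
    + by move=> y _; rewrite lee_fin spin2_mass_ge0.
  - apply/measurable_EFinP; apply: measurable_funTS.
    by apply: measurable_funD => //; exact: measurable_funM.
  - move=> y _; rewrite lee_fin; have := spin2_mass_ge0 z (r1 y).
    by rewrite /spin2_mass pmulr_rge0// invr_gt0.
rewrite [RHS]ge0_integral_pushforward//.
- by apply/measurable_EFinP; exact: measurable_funX.
- by move=> y _; rewrite lee_fin sqr_ge0.
Qed.

Lemma statistic_flip_output (T : Y -> Y) (r : Y -> R) c y : (forall y, r (T y) = - r y) ->
  r (flip_output T c y) = sgn R c * r y.
Proof. by move=> rT; case: c; rewrite /sgn/= ?mul1r// rT mulN1r. Qed.

(** Expresses the channel and its information through [Q true], the only edge law seen under the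
    all-plus input. For the information this is possible because [r ^+ 2] is invariant under [T]. *)
Lemma symmetric_edge_statistic (T : Y -> Y) : measurable_fun setT T ->
  involutive T -> (forall A, measurable A -> Q true A = Q false (T @` A)) ->
  exists r : Y -> R,
  [/\ measurable_fun setT r, forall y, `|r y| <= 1, forall y, r (T y) = - r y,
      forall b A, measurable A -> (Q b A = \int[Q true]_y \sum_(c : spin)
        (2^-1 * ((1 + sgn R b * (sgn R c * r y)) *
                 \1_A (flip_output T c y)))%:E)%E &
      edge_chi2_mi Q = (\int[Q true]_y (r y ^+ 2)%:E)%E].
Proof.
move=> mT TK QT; have [r [mr r1 rT Qr]] := symmetric_edge_density mT TK QT.
exists r; split => //.
  move=> b A mA; rewrite Qr// integral_mkcond.
  rewrite (eq_integral (fun y => ((1 + sgn R b * r y) * \1_A y)%:E)); last first.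
    move=> y _; rewrite patchE indicE; case: (_ \in _); first by rewrite mulr1.
    by rewrite mulr0.
  rewrite (integral_edge_output_law mT TK QT).
  - by apply: eq_integral => y _; apply: eq_bigr => c _; rewrite statistic_flip_output// -EFinM.
  - apply/measurable_EFinP; apply: measurable_funM; last exact: measurable_indic.
    by apply: measurable_funD => //; exact: measurable_funM.
  - move=> y; rewrite lee_fin mulr_ge0//; have := r1 y; rewrite ler_norml => /andP[].
    by case: b; rewrite /sgn; lra.
rewrite (edge_chi2_miE mr r1 Qr) (integral_edge_output_law mT TK QT).
- apply: eq_integral => y _; rewrite big_bool !statistic_flip_output// !exprMn !sqr_sgn/=.
  by rewrite -!EFinM -EFinD; congr EFin; lra.
- by apply/measurable_EFinP; exact: measurable_funX.
- by move=> y; rewrite lee_fin sqr_ge0.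
Qed.

End edge_statistic.

(** * The space of outputs *)

Section output_space.
Context (n : nat) (d : edge n -> measure_display).
Context (Yt : forall e, measurableType (d e)).
Implicit Types (g : graph n) (A : forall e, set (Yt e)) (y : output Yt).

(** A coordinate defined on all outputs, equal to [point] off the graph; matching on [idP] recovers
    the membership proof needed to read the output. *)
Definition out_coord e (y : output Yt) : Yt e :=
  match @idP (e \in projT1 (y : raw_output Yt)) with
  | ReflectT eg => (projT2 (y : raw_output Yt) : alphabet Yt _) e eg
  | ReflectF _ => point
  end.

Lemma out_coordE y e (eg : e \in projT1 (y : raw_output Yt)) :
  out_coord e y = (projT2 (y : raw_output Yt) : alphabet Yt _) e eg.
Proof.
rewrite /out_coord; case: {-}_ / idP => [eg'|//].
by rewrite (bool_irrelevance eg eg').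
Qed.

Lemma output_boxE g A y : output_box g A y <->
  output_graph y = g /\ (forall e, e \in g -> A e (out_coord e y)).
Proof.
split=> -[yg yA]; split => //.
  by move=> e; rewrite -yg => eg; rewrite (out_coordE eg).
by move=> e eg; rewrite -out_coordE; apply: yA; rewrite -yg.
Qed.

Lemma measurable_output_box g A : (forall e, measurable (A e)) ->
  measurable (output_box g A : set (output Yt)).
Proof. by move=> mA; apply: sub_sigma_algebra; exists g, A. Qed.

Lemma output_graph_preimage g :
  @output_graph n d Yt @^-1` [set g] = output_box g (fun=> setT).
Proof.
by apply/seteqP; split => y /=; [move=> yg; apply/output_boxE|case/output_boxE].
Qed.

Lemma measurable_output_graph g :
  measurable (@output_graph n d Yt @^-1` [set g]).
Proof. by rewrite output_graph_preimage; exact: measurable_output_box. Qed.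

Lemma measurable_fun_output_pieces (dZ : measure_display) (Z : measurableType dZ)
    (f : output Yt -> Z) :
  (forall g B, measurable B ->
     measurable (@output_graph n d Yt @^-1` [set g] `&` f @^-1` B)) ->
  measurable_fun setT f.
Proof.
move=> mf _ B mB; rewrite setTI.
rewrite (_ : f @^-1` B = \bigcup_(g in [set: graph n])
   (@output_graph n d Yt @^-1` [set g] `&` f @^-1` B)).
  by apply: fin_bigcup_measurable => [|g _]; [exact: finite_finset|exact: mf].
by apply/seteqP; split => [y By|y [g _ []]//]; exists (output_graph y).
Qed.

Lemma measurable_out_coord e : measurable_fun setT (out_coord e).
Proof.
apply: measurable_fun_output_pieces => g B mB.
have [eg|eg] := boolP (e \in g).
  rewrite (_ : _ `&` _ = output_box g (dfwith (fun e' => [set: Yt e']) e B)).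
    apply: measurable_output_box => e'.
    by case: dfwithP.
  apply/seteqP; split => y.
    move=> [yg By]; apply/output_boxE; split => // e' _.
    by case: dfwithP.
  by move=> /output_boxE[yg /(_ e eg)]; rewrite dfwithin.
rewrite (_ : _ `&` _ = if `[<B point>] then
   @output_graph n d Yt @^-1` [set g] else set0).
  by case: ifP => // _; exact: measurable_output_graph.
have ce y : output_graph y = g -> out_coord e y = point.
  move=> yg; rewrite /out_coord; case: {-}_ / idP => // eg'.
  by exfalso; move: eg; rewrite -yg => /negP; apply.
case: asboolP => Bp; apply/seteqP; split => y //=.
- by case.
- by move=> yg; rewrite ce.
- by case=> yg; rewrite ce.
Qed.

Definition map_output (t : forall e, Yt e -> Yt e) (y : output Yt) : output Yt :=
  existT (@alphabet n d Yt) (projT1 (y : raw_output Yt))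
    (fun e eg => t e ((projT2 (y : raw_output Yt) : alphabet Yt _) e eg)).

Lemma output_graph_map t y : output_graph (map_output t y) = output_graph y.
Proof. by []. Qed.

Lemma out_coord_map t y e : e \in output_graph y ->
  out_coord e (map_output t y) = t e (out_coord e y).
Proof. by move=> eg; rewrite (out_coordE (y := map_output t y) eg) (out_coordE eg). Qed.

Lemma map_output_box t g A :
  map_output t @^-1` output_box g A = output_box g (fun e => t e @^-1` A e).
Proof.
apply/seteqP; split => y /=; rewrite !output_boxE => -[yg yA]; split => // e eg.
  have yg' : output_graph y = g := yg.
  by have := yA e eg; rewrite out_coord_map ?yg'.
by rewrite out_coord_map ?yg//; exact: yA.
Qed.

Lemma measurable_map_output t : (forall e, measurable_fun setT (t e)) ->
  measurable_fun setT (map_output t).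
Proof.
move=> mt; apply: (@measurability _ _ (output Yt) (output Yt) setT (map_output t)
  (@output_boxes n d Yt)) => //.
move=> _ [_ [g [A [mA ->]]] <-]; rewrite setTI map_output_box.
apply: measurable_output_box => e.
by rewrite -[X in measurable X]setTI; exact: mt.
Qed.

Lemma output_boxes_setI_closed : setI_closed (@output_boxes n d Yt).
Proof.
move=> _ _ [g [A [mA ->]]] [g' [A' [mA' ->]]].
have [<-|gg'] := eqVneq g g'.
  exists g, (fun e => A e `&` A' e); split => [e|]; first exact: measurableI.
  apply/seteqP; split => y /=.
    by move=> [[yg yA] [_ yA']]; split.
  move=> [yg yA]; split; split => // e eg; [exact: (yA e eg).1|exact: (yA e eg).2].
have -> : output_box g A `&` output_box g' A' = set0.
  by apply/seteqP; split => // y [[yg _] [yg' _]]; rewrite -yg -yg' eqxx in gg'.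
(* The empty set must itself be presented as a box, which requires an edge whose side is empty. Two
   distinct graphs cannot both be edgeless. *)
have [h [e eh]] : exists h : graph n, exists e, e \in h.
  have [g0|[e eg]] := set_0Vmem g; last by exists g, e.
  have [g'0|[e eg]] := set_0Vmem g'; last by exists g', e.
  by rewrite g0 g'0 eqxx in gg'.
exists h, (fun=> set0); split => //.
by apply/seteqP; split => // y /output_boxE[_ /(_ e eh)].
Qed.

(** The boxes are stable under intersection and generate the sigma-algebra, and the full boxes of
    the finitely many graphs cover the space. Past the end of the enumeration, [G] repeats the box
    of the empty graph. *)
Lemma output_measure_unique (R : realType)
    (m1 m2 : {measure set (output Yt) -> \bar R}) :
  (m1 setT < +oo)%E ->
  (forall g A, (forall e, measurable (A e)) ->
     m1 (output_box g A) = m2 (output_box g A)) ->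
  forall B, measurable B -> m1 B = m2 B.
Proof.
move=> m1oo m12.
pose G k : set (output Yt) :=
  output_box (nth finset.set0 (enum {: graph n}) k) (fun=> setT).
have mG k : measurable (G k) by exact: measurable_output_box.
move=> B mB.
apply: (@measure_unique _ R (output Yt) (@output_boxes n d Yt) G) => //.
- exact: output_boxes_setI_closed.
- by move=> k; eexists; exists (fun=> setT).
- apply/seteqP; split => // y _.
  exists (index (output_graph y) (enum {: graph n})) => //.
  by apply/output_boxE; rewrite nth_index// mem_enum inE.
- by move=> _ [g [A [mA ->]]]; exact: m12.
- move=> k; apply: le_lt_trans m1oo; apply: le_measure => //; rewrite inE//.
Qed.

End output_space.

(** * The posterior of a synchronization instance *)

Section synchronization_law.
Context (R : realType) (n : nat) (d : edge n -> measure_display).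
Context (Yt : forall e, measurableType (d e)).
Variable Q : forall e, spin -> probability (Yt e) R.
Context (dO : measure_display) (Omega : measurableType dO).
Variable P : probability Omega R.
Variables (G : Omega -> graph n) (X : 'I_n -> {RV P >-> spin}).
Variable Y : {RV P >-> output Yt}.
Hypothesis sync : sync_instance Q G X Y.
Implicit Types (g : graph n) (x : 'I_n -> spin) (e : edge n).

Definition spins_graph x g : set Omega :=
  [set w | (forall i, X i w = x i) /\ G w = g].

Let mY B : measurable B -> measurable (Y @^-1` B).
Proof. by move=> mB; rewrite -[X in measurable X]setTI; exact: measurable_funP. Qed.

Lemma measurable_G g : measurable [set w | G w = g].
Proof.
rewrite (_ : [set w | _] = Y @^-1` (@output_graph n d Yt @^-1` [set g])).
  by apply: mY; exact: measurable_output_graph.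
by apply/seteqP; split => w /=; rewrite (output_graphE sync).
Qed.

Lemma measurable_spins x : measurable [set w | forall i, X i w = x i].
Proof.
rewrite (_ : [set w | _] = \bigcap_(i in [set: 'I_n]) X i @^-1` [set x i]).
  apply: fin_bigcap_measurable => [|i _]; first exact: finite_finset.
  by rewrite -[X in measurable X]setTI; exact: measurable_funP.
by apply/seteqP; split => w /= h i; [move=> _; exact: h|exact: h].
Qed.

Lemma measurable_spins_graph x g : measurable (spins_graph x g).
Proof. by apply: measurableI; [exact: measurable_spins|exact: measurable_G]. Qed.

Lemma probability_spins_graph x g :
  P (spins_graph x g) = ((2 ^+ n)^-1%:E * P [set w | G w = g])%E.
Proof.
by rewrite /spins_graph (input_graph_indep sync) (input_uniform sync).
Qed.

Lemma prode_EFin (I : Type) (s : seq I) (p : pred I) (f : I -> R) :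
  \big[*%E/1%E]_(i <- s | p i) (f i)%:E = (\prod_(i <- s | p i) f i)%:E.
Proof. by rewrite (big_morph EFin (id1 := 1%E) (op1 := *%E)). Qed.

(* The inputs are taken to be constantly +1, so that every edge input is +1. *)
Lemma integral_prod_coord g (h : forall e, Yt e -> R) (I : edge n -> R) :
  (forall e, measurable_fun setT (h e)) -> (forall e y, 0 <= h e y) ->
  (forall e, e \in g -> \int[Q e true]_y (h e y)%:E = (I e)%:E)%E ->
  (\int[P]_(w in spins_graph (fun=> true) g)
     (\prod_(e in g) h e (out_coord e (Y w)))%:E =
   P (spins_graph (fun=> true) g) * (\prod_(e in g) I e)%:E)%E.
Proof.
move=> mh h0 hI.
set D := spins_graph _ g.
have [p pE] : exists p, P D = p%:E.
  exists (fine (P D)); rewrite fineK// fin_num_measure//.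
  exact: measurable_spins_graph.
have p0 : 0 <= p by rewrite -lee_fin -pE measure_ge0.
have I0 e : e \in g -> 0 <= I e.
  by move=> eg; rewrite -lee_fin -hI// integral_ge0// => y _; rewrite lee_fin.
pose plus := [set w | forall i, X i w = true].
have mplus : measurable plus by exact: (measurable_spins (fun=> true)).
have mprod (S : graph n) : measurable_fun setT
    (fun w => \prod_(e in S) h e (out_coord e (Y w))).
  under eq_fun do rewrite -big_enum/=.
  apply: measurable_prod => e _; apply: (measurableT_comp (mh e)).
  by apply: measurableT_comp => //; exact: measurable_out_coord.
have mDA A : (forall e, measurable (A e)) ->
    measurable (plus `&` Y @^-1` (output_box g A : set (output Yt))).
  by move=> mA; apply: measurableI => //; apply: mY; exact: measurable_output_box.
(* Edges of [S] carry the function [h], the others an event. Keeping these events arbitrary is what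
   allows the induction to trade one more of them for a function. *)
have key k : forall S : graph n, (#|S| <= k)%N -> S \subset g ->
   forall A, (forall e, measurable (A e)) ->
   (forall e, e \in S -> A e = setT) ->
   (\int[P]_(w in plus `&` Y @^-1` (output_box g A : set (output Yt)))
      (\prod_(e in S) h e (out_coord e (Y w)))%:E =
    (p * ((\prod_(e in S) I e) * \prod_(e in g :\: S) fine (Q e true (A e))))%:E)%E.
  elim: k => [|k IH] S Sk Sg A mA AS.
    move: Sk; rewrite leqn0 cards_eq0 => /eqP S0.
    rewrite S0 (eq_integral (cst 1%E)); last by move=> w _; rewrite big_set0.
    rewrite integral_cst; last exact: mDA.
    rewrite mul1e finset.setD0 big_set0 mul1r.
    apply: eq_trans (output_law sync (fun=> true) g mA) _.
    rewrite EFinM -prode_EFin -pE; congr (_ * _)%E.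
    by apply: eq_bigr => e _; rewrite fineK// fin_num_measure.
  have [S0|[e eS]] := set_0Vmem S.
    by apply: IH => //; rewrite S0 cards0.
  have eg : e \in g by exact: (fintype.subsetP Sg).
  pose S' := S :\ e.
  have eS' : e \notin S' by rewrite !finset.inE eqxx.
  have S'k : (#|S'| <= k)%N by move: Sk; rewrite (cardsD1 e) eS.
  have S'g : S' \subset g by apply: fintype.subset_trans Sg; exact: subD1set.
  have gS' : g :\: S' = e |: (g :\: S).
    apply/setP => e'; rewrite !finset.inE; have [->|//] := eqVneq e' e.
    by rewrite eg eS.
  pose K := (\prod_(e in S') I e) * \prod_(e in g :\: S) fine (Q e true (A e)).
  have pK0 : 0 <= p * K.
    rewrite mulr_ge0// mulr_ge0// prodr_ge0// => e'; last by rewrite fine_ge0.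
    by move=> e'S; apply: I0; exact: (fintype.subsetP S'g).
  (* The functions on [S'] form the weight and coordinate [e] is the map. The image measure is
     [p * K] times [Q e true], by the induction hypothesis with [B] as the event at [e]. *)
  have := @ge0_integral_weighted_pushforward _ _ _ _ R P
     (plus `&` Y @^-1` (output_box g A : set (output Yt))) 'I_1
     (fun _ w => \prod_(e in S') h e (out_coord e (Y w)))
     (fun _ w => out_coord e (Y w)) (mDA A mA) (fun _ => mprod S').
  move=> /(_ _ _ (mscale (NngNum pK0) (Q e true)) _ (EFin \o h e)) H.
  rewrite (eq_integral (fun w => \sum_(i : 'I_1)
     (\prod_(e in S') h e (out_coord e (Y w)))%:E *
     (h e (out_coord e (Y w)))%:E)%E); last first.
    move=> w _; rewrite big_ord1 -EFinM -{1}(finset.setD1K eS) big_setU1//=.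
    by rewrite mulrC.
  rewrite -H => {H}.
  - rewrite ge0_integral_mscale//=.
    + rewrite hI// -EFinM; congr EFin.
      by rewrite /K -{2}(finset.setD1K eS) big_setU1//=; ring.
    + exact/measurable_EFinP.
    + by move=> y _; rewrite lee_fin.
  - by move=> _; apply: measurableT_comp => //; exact: measurable_out_coord.
  - by move=> _ w; rewrite prodr_ge0.
  - move=> B mB.
    rewrite (eq_integral (fun w => (\prod_(e in S') h e (out_coord e (Y w)))%:E *
      (\1_(Y @^-1` (out_coord e @^-1` B)) w)%:E)%E); last first.
      move=> w _; rewrite big_ord1 EFinM !indicE; congr (_ * (nat_of_bool _)%:R%:E)%E.
    pose A' := dfwith A e B.
    have A'e : A' e = B by rewrite /A' dfwithin.
    have A'e' e' : e' != e -> A' e' = A e'.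
      by move=> e'e; rewrite /A' dfwithout// eq_sym.
    transitivity (\int[P]_(w in plus `&` Y @^-1` (output_box g A' : set (output Yt)))
      (\prod_(e in S') h e (out_coord e (Y w)))%:E)%E.
      rewrite IH//; first last.
      + by move=> e' e'S; rewrite A'e' ?AS//; move: e'S; rewrite !finset.inE => /andP[].
      + move=> e'; have [->|e'e] := eqVneq e' e; first by rewrite A'e.
        by rewrite A'e'.
      rewrite gS' big_setU1/= ?finset.inE ?eS// A'e.
      rewrite [X in _ = (p * (_ * (_ * X)))%:E](eq_bigr
        (fun e => fine (Q e true (A e)))); last first.
        move=> e' /setDP[_ e'S]; rewrite A'e'//.
        by apply: contra e'S => /eqP ->.
      rewrite /mscale/= -[in LHS](@fineK _ (Q e true B)) ?fin_num_measure//.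
      by rewrite -EFinM; congr EFin; rewrite /K; ring.
    rewrite (_ : _ `&` _ = (plus `&` Y @^-1` (output_box g A : set (output Yt))) `&`
       (Y @^-1` (out_coord e @^-1` B))); last first.
      apply/seteqP; split => w /=.
        move=> [pw /output_boxE[yg yA]]; split; last by rewrite -A'e; exact: yA.
        split => //; apply/output_boxE; split => // e' e'g.
        have := yA e' e'g; have [->|e'e] := eqVneq e' e; last by rewrite A'e'.
        by rewrite AS.
      move=> [[pw /output_boxE[yg yA]] yB]; split => //.
      apply/output_boxE; split => // e' e'g.
      by have [->|e'e] := eqVneq e' e; rewrite ?A'e// A'e'//; exact: yA.
    rewrite integral_mkcondr; apply: eq_integral => w _.
    rewrite patchE indicE; case: (_ \in _); first by rewrite mule1.
    by rewrite mule0.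
  - exact/measurable_EFinP.
  - by move=> y; rewrite lee_fin.
have := key #|g| g (leqnn _) (fintype.subxx _) (fun=> setT)
  (fun=> measurableT) (fun _ _ => erefl).
rewrite finset.setDv big_set0 mulr1 pE EFinM => <-.
rewrite (_ : D = plus `&` Y @^-1` (output_box g (fun=> setT) : set (output Yt)))//.
apply/seteqP; split => w /= [pw].
  by move=> Gw; split => //; apply/output_boxE; rewrite (output_graphE sync).
by move=> /output_boxE[]; rewrite (output_graphE sync).
Qed.

End synchronization_law.

(** * Law of the output and posterior correlation on a fixed graph *)

Section posterior.
Context (R : realType) (n : nat) (d : edge n -> measure_display).
Context (Yt : forall e, measurableType (d e)).
Variable Q : forall e, spin -> probability (Yt e) R.
Context (dO : measure_display) (Omega : measurableType dO).
Variable P : probability Omega R.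
Variables (G : Omega -> graph n) (X : 'I_n -> {RV P >-> spin}).
Variable Y : {RV P >-> output Yt}.
Hypothesis sync : sync_instance Q G X Y.
Variables (T : forall e, Yt e -> Yt e) (r : forall e, Yt e -> R).
Arguments T : clear implicits.
Arguments r : clear implicits.
Hypotheses (mT : forall e, measurable_fun setT (T e))
  (mr : forall e, measurable_fun setT (r e))
  (r1 : forall e y, `|r e y| <= 1) (rT : forall e y, r e (T e y) = - r e y).
Implicit Types (g : graph n) (e : edge n) (s : {ffun edge n -> spin}).
Implicit Types (x : {ffun 'I_n -> spin}) (y : output Yt) (u v : 'I_n).

Definition statistic y e : R := r e (out_coord e y).

Definition flip_outputs s : output Yt -> output Yt :=
  map_output (fun e => flip_output (T e) (s e)).

Definition flip_statistic s y e : R := sgn R (s e) * statistic y e.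

Lemma measurable_flip_outputs s : measurable_fun setT (flip_outputs s).
Proof.
by apply: measurable_map_output => e; exact: measurable_flip_output.
Qed.

Lemma statistic_flip s y e : e \in output_graph y ->
  statistic (flip_outputs s y) e = flip_statistic s y e.
Proof.
by move=> ey; rewrite /statistic /flip_outputs out_coord_map// statistic_flip_output.
Qed.

Lemma measurable_statistic e : measurable_fun setT (statistic^~ e).
Proof.
by apply: (measurableT_comp (@mr e)); exact: measurable_out_coord.
Qed.

Lemma measurable_flip_statistic s e : measurable_fun setT (flip_statistic s ^~ e).
Proof. by apply: measurable_funM => //; exact: measurable_statistic. Qed.

Lemma flip_statistic_le1 s y e : `|flip_statistic s y e| <= 1.
Proof. by rewrite /flip_statistic normrM normr_sgn mul1r; exact: r1. Qed.

Lemma measurable_weight (f : output Yt -> edge n -> R) g x :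
  (forall e, measurable_fun setT (f^~ e)) ->
  measurable_fun setT (fun y => weight g (f y) x).
Proof.
move=> mf; rewrite /weight; under eq_fun do rewrite -big_enum/=.
apply: measurable_prod => e _; apply: measurable_funD => //.
exact: measurable_funM.
Qed.

Lemma measurable_avg (I : finType) (f : I -> output Yt -> R) :
  (forall i, measurable_fun setT (f i)) ->
  measurable_fun setT (fun y => avg (f^~ y)).
Proof.
by move=> mf; apply: measurable_funM => //; exact: measurable_sum.
Qed.

Let card_s := #|{: {ffun edge n -> spin}}|%:R : R.

(* For [p = pred1 x], the weight of (x, flip_outputs s y) when the law of (X, Y)
   on G = g is recovered from the law of Y on X = (+1, ..., +1) and G = g. *)
Definition flip_density g (p : pred {ffun 'I_n -> spin}) s y : R :=
  card_s^-1 * \sum_(x | p x) weight g (flip_statistic s y) x.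

Lemma flip_density_ge0 g p s y : 0 <= flip_density g p s y.
Proof.
rewrite mulr_ge0 ?invr_ge0//; apply: sumr_ge0 => x _.
by apply: weight_ge0 => e _; exact: flip_statistic_le1.
Qed.

Lemma measurable_flip_density g p s : measurable_fun setT (flip_density g p s).
Proof.
apply: measurable_funM => //.
under eq_fun do rewrite -big_filter.
apply: measurable_sum => x; apply: measurable_weight.
exact: measurable_flip_statistic.
Qed.

Definition posterior_correlation u v y : R :=
  correlation (output_graph y) u v (statistic y) /
  evidence (output_graph y) (statistic y).

Lemma posterior_correlation_le1 u v y : `|posterior_correlation u v y| <= 1.
Proof.
have s1 : {in output_graph y, forall e, `|statistic y e| <= 1}.
  by move=> e _; exact: r1.
have := @evidence_ge0 _ _ _ (statistic y) s1.
have := @correlation_le _ _ _ u v (statistic y) s1.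
move=> ca a0; rewrite /posterior_correlation normrM normfV (ger0_norm a0).
move: (evidence _ _) a0 ca => a a0 ca.
move: a0; rewrite le0r => /orP[/eqP ->|a0]; first by rewrite invr0 mulr0.
by rewrite ler_pdivrMr// mul1r.
Qed.

Lemma measurable_posterior_correlation u v :
  measurable_fun setT (posterior_correlation u v).
Proof.
have s1 h y : {in h, forall e, `|statistic y e| <= 1} by move=> e _; exact: r1.
have mw h x := measurable_weight h x measurable_statistic.
apply: measurable_fun_output_pieces => h B mB.
(* The evidence is nonnegative, so its inverse is its power -1, including the value 0 at 0;
   measurability follows on each piece. *)
have mf : measurable_fun setT
    (fun y => correlation h u v (statistic y) * (evidence h (statistic y)) `^ (-1)).
  apply: measurable_funM.
    by apply: measurable_avg => x; exact: measurable_funM.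
  have mE : measurable_fun setT (fun y => evidence h (statistic y)).
    by apply: (measurable_avg (f := fun x y => weight h (statistic y) x)).
  exact: (measurableT_comp (@measurable_powR R (-1)) mE).
rewrite (_ : _ `&` _ = @output_graph n d Yt @^-1` [set h] `&` ((fun y =>
  correlation h u v (statistic y) * (evidence h (statistic y)) `^ (-1)) @^-1` B)).
  apply: measurableI; first exact: measurable_output_graph.
  by rewrite -[X in measurable X]setTI; exact: mf.
apply/seteqP; split => y /=; rewrite /posterior_correlation => -[yh].
  by rewrite yh powR_inv1// evidence_ge0.
by rewrite yh powR_inv1// evidence_ge0.
Qed.

Let s0 : card_s != 0.
Proof. by rewrite pnatr_eq0 -lt0n; apply/card_gt0P; exists [ffun=> true]. Qed.

Lemma flip_density_predT g s y : flip_density g predT s y =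
  #|{: {ffun 'I_n -> spin}}|%:R / card_s * evidence g (flip_statistic s y).
Proof.
have x0 : (#|{: {ffun 'I_n -> spin}}|%:R : R) != 0.
  by rewrite pnatr_eq0 -lt0n; apply/card_gt0P; exists [ffun=> true].
rewrite /flip_density /evidence /avg.
under eq_bigl do rewrite /=.
by field; rewrite x0 s0.
Qed.

Lemma flip_density_pair g u v (z : spin * spin) s y :
  flip_density g (fun x => (x u == z.1) && (x v == z.2)) s y =
  #|{: {ffun 'I_n -> spin}}|%:R / card_s *
  (4^-1 * (evidence g (flip_statistic s y) +
     sgn R (spin_mul z.1 z.2) * correlation g u v (flip_statistic s y))).
Proof.
have x0 : (#|{: {ffun 'I_n -> spin}}|%:R : R) != 0.
  by rewrite pnatr_eq0 -lt0n; apply/card_gt0P; exists [ffun=> true].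
rewrite -avg_weight_pair /flip_density big_mkcond/= /avg.
rewrite [X in _ = _ * (X / _)](eq_bigr (fun x : {ffun 'I_n -> spin} =>
  if (x u == z.1) && (x v == z.2) then weight g (flip_statistic s y) x else 0)).
  by field; rewrite x0 s0.
by move=> x _; case: ifP; rewrite ?mul1r ?mul0r.
Qed.

Variable g : graph n.
Hypothesis Qr : forall e, e \in g -> forall b A, measurable A ->
  (Q e b A = \int[Q e true]_y \sum_(c : spin)
     (2^-1 * ((1 + sgn R b * (sgn R c * r e y)) *
              \1_A (flip_output (T e) c y)))%:E)%E.

Let D := spins_graph G X (fun=> true) g.

Let mD : measurable D.
Proof. exact: (measurable_spins_graph sync). Qed.

Let outG w : D w -> output_graph (Y w) = g.
Proof. by move=> [_ <-]; rewrite (output_graphE sync). Qed.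

Let mYf (dZ : measure_display) (Z : measurableType dZ) (f : output Yt -> Z) :
  measurable_fun setT f -> measurable_fun setT (fun w => f (Y w)).
Proof. by move=> mf; apply: measurableT_comp. Qed.

(** On a box both sides factor over the edges. For a fixed sign pattern the right side is an
    integral of a product of functions of single coordinates; averaging each sign turns its factor
    into [Q e] of the side of the box, by [Qr]. *)
Let sub_integral_box x (A : forall e, set (Yt e)) : (forall e, measurable (A e)) ->
  P (spins_graph G X x g `&` Y @^-1` (output_box g A : set (output Yt))) =
  (\int[P]_(w in D) \sum_s (flip_density g (pred1 x) s (Y w) *
     \1_(output_box g A : set (output Yt)) (flip_outputs s (Y w)))%:E)%E.
Proof.
move=> mA; pose xe e := spin_mul (x (src e)) (x (tgt e)).
pose h c e (y : Yt e) :=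
  (1 + sgn R (xe e) * (sgn R c * r e y)) * \1_(A e) (flip_output (T e) c y).
have mh c e : measurable_fun setT (h c e).
  apply: measurable_funM.
    by apply: measurable_funD => //; apply: measurable_funM => //; exact: measurable_funM.
  apply: measurableT_comp; first exact: measurable_indic.
  exact: measurable_flip_output.
have h01 c e (y : Yt e) : 0 <= h c e y <= 2.
  have : `|sgn R (xe e) * (sgn R c * r e y)| <= 1 by rewrite !normrM !normr_sgn !mul1r.
  rewrite ler_norml /h indicE; case: (_ \in _); rewrite ?mulr0 ?mulr1; lra.
have h0 c e (y : Yt e) : 0 <= h c e y by case/andP: (h01 c e y).
pose I c e := fine (\int[Q e true]_y (h c e y)%:E)%E.
have hI c e : (\int[Q e true]_y (h c e y)%:E = (I c e)%:E)%E.
  rewrite fineK// ge0_fin_numE; last by apply: integral_ge0 => y _; rewrite lee_fin.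
  apply: (@le_lt_trans _ _ (\int[Q e true]_y (cst 2%:E y)))%E.
    apply: ge0_le_integral => //.
    - by move=> y _; rewrite lee_fin.
    - exact/measurable_EFinP.
    - by move=> y _; rewrite lee_fin; case/andP: (h01 c e y).
  by rewrite integral_cst// [X in (_ * X)%E]probability_setT mule1 ltry.
have QI e : e \in g -> fine (Q e (xe e) (A e)) = (I true e + I false e) / 2.
  move=> eg; rewrite (Qr eg _ (mA e)) ge0_integral_sum//.
  - have E c : (\int[Q e true]_y (2^-1 * h c e y)%:E = (2^-1 * I c e)%:E)%E.
      under eq_integral do rewrite EFinM.
      rewrite ge0_integralZl// ?hI//; first exact/measurable_EFinP.
      by move=> y _; rewrite lee_fin.
    by rewrite big_bool !E/=; lra.
  - by move=> c; apply/measurable_EFinP; apply: measurable_funM => //; exact: (mh c e).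
  - by move=> c y _; rewrite lee_fin mulr_ge0//; exact: (h0 c e y).
have -> : P (spins_graph G X x g `&` Y @^-1` (output_box g A : set (output Yt))) =
    (P D * (avg (fun s => \prod_(e in g) I (s e) e))%:E)%E.
  rewrite (_ : _ `&` _ =
    [set w | (forall i, X i w = x i) /\ output_box g A (Y w)]); last first.
    apply/seteqP; split => w /=; first by move=> [[? _] ?].
    move=> [Xx yA]; split => //; split => //.
    by case/output_boxE: yA => + _; rewrite (output_graphE sync).
  rewrite (output_law sync)// -/(spins_graph G X x g).
  rewrite (avg_prod g (fun e c => I c e)) -prode_EFin.
  (* The input is uniform and independent of the graph, so the all-plus event is as likely as any
     other. *)
  have -> : P (spins_graph G X x g) = P D.
    by rewrite /D !(probability_spins_graph sync).
  congr (_ * _)%E; apply: eq_bigr => e eg; rewrite -QI// fineK// fin_num_measure//.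
rewrite (eq_integral (fun w => \sum_(s : {ffun edge n -> spin}) (card_s^-1)%:E *
   (\prod_(e in g) h (s e) e (out_coord e (Y w)))%:E)%E); last first.
  move=> w; rewrite inE => Dw; apply: eq_bigr => s _.
  rewrite -EFinM; congr EFin; rewrite /flip_density big_pred1_eq -mulrA; congr (_ * _).
  rewrite big_split/=; congr (_ * _).
  rewrite indicE; have [yA|yA] := boolP (flip_outputs s (Y w) \in _).
    rewrite big1// => e eg; rewrite indicE mem_set//.
    move: yA; rewrite inE => /output_boxE[_ /(_ e eg)].
    by rewrite out_coord_map// outG.
  have [e eg eA] : exists2 e, e \in g &
     ~ A e (flip_output (T e) (s e) (out_coord e (Y w))).
    move: yA; rewrite notin_setE => yA.
    apply: contrapT => H; apply: yA; apply/output_boxE; split; first exact: outG.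
    move=> e eg; rewrite out_coord_map ?outG//.
    by apply: contrapT => nA; apply: H; exists e.
  by rewrite (bigD1 e)//= indicE memNset// mul0r.
rewrite ge0_integral_sum//.
- rewrite (eq_bigr (fun s => (card_s^-1)%:E * (P D * (\prod_(e in g) I (s e) e)%:E))%E).
    have pf : P D \is a fin_num by exact: fin_num_measure.
    rewrite -(fineK pf); under [RHS]eq_bigr do rewrite -!EFinM.
    rewrite sumEFin -EFinM; congr EFin; rewrite /avg mulrA mulr_sumr mulr_suml.
    by apply: eq_bigr => s _; rewrite [RHS]mulrC.
  move=> s _; rewrite ge0_integralZl//.
  + by rewrite (integral_prod_coord sync (h := fun e => h (s e) e)
      (I := fun e => I (s e) e)).
  + apply/measurable_EFinP; apply: measurable_funTS.
    under eq_fun do rewrite -big_enum/=.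
    apply: measurable_prod => e _; apply: (mYf (f := fun y => h (s e) e (out_coord e y))).
    by apply: measurableT_comp => //; exact: measurable_out_coord.
  + by move=> w _; rewrite lee_fin prodr_ge0.
  + by rewrite lee_fin invr_ge0.
- move=> s; apply: measurable_funeM; apply/measurable_EFinP; apply: measurable_funTS.
  under eq_fun do rewrite -big_enum/=.
  apply: measurable_prod => e _; apply: (mYf (f := fun y => h (s e) e (out_coord e y))).
  by apply: measurableT_comp => //; exact: measurable_out_coord.
- by move=> s w _; rewrite -EFinM lee_fin mulr_ge0 ?invr_ge0// prodr_ge0.
Qed.

(** Both sides are measures in [B]; they agree on the boxes over [g], and both vanish on the boxes
    over other graphs. *)
Lemma spins_law x B : measurable B ->
  P (spins_graph G X x g `&` Y @^-1` B) =
  (\int[P]_(w in D) \sum_s (flip_density g (pred1 x) s (Y w) *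
     \1_B (flip_outputs s (Y w)))%:E)%E.
Proof.
move=> mB; have mYT : measurable_fun setT (Y : Omega -> output Yt).
  exact: measurable_funP.
have [m1 [m1E _]] := restricted_law P (measurable_spins_graph sync x g) mYT.
have [m2 m2E] := @weighted_pushforward_measure _ _ _ _ R P D _
  (fun s w => flip_density g (pred1 x) s (Y w)) (fun s w => flip_outputs s (Y w)) mD
  (fun s => mYf (measurable_flip_density g _ s))
  (fun s => mYf (@measurable_flip_outputs s)) (fun s w => flip_density_ge0 _ _ _ _).
rewrite -m1E// -m2E//; apply: output_measure_unique => //.
  rewrite m1E//; apply: (@le_lt_trans _ _ 1%E); last exact: ltry.
  apply: probability_le1; rewrite preimage_setT setIT.
  exact: (measurable_spins_graph sync).
move=> h A mA; have mbox := measurable_output_box h mA.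
rewrite m1E// m2E//; have [->|hg] := eqVneq h g; first exact: sub_integral_box.
rewrite (_ : _ `&` _ = set0) ?measure0.
  apply/esym; apply: integral0_eq => w Dw; apply: big1 => s _.
  rewrite indicE memNset ?mulr0// => /output_boxE[+ _].
  by rewrite output_graph_map outG// => gh; rewrite gh eqxx in hg.
apply/seteqP; split => // w /= [[_ Gw] /output_boxE[+ _]].
by rewrite (output_graphE sync) Gw => gh; rewrite gh eqxx in hg.
Qed.

Let mD_sum (I : finType) (f : I -> output Yt -> R) :
  (forall i, measurable_fun setT (f i)) ->
  measurable_fun D (fun w => (\sum_i (f i (Y w))%:E)%E).
Proof.
move=> mf; apply: measurable_funTS; apply: emeasurable_sum => i.
by apply/measurable_EFinP; exact: (mYf (mf i)).
Qed.

Lemma spins_pred_law (p : pred {ffun 'I_n -> spin}) B : measurable B ->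
  P ([set w | p [ffun i => X i w]] `&` ([set w | G w = g] `&` Y @^-1` B)) =
  (\int[P]_(w in D) \sum_s (flip_density g p s (Y w) *
     \1_B (flip_outputs s (Y w)))%:E)%E.
Proof.
move=> mB; pose f w : {ffun 'I_n -> spin} := [ffun i => X i w].
have fE x : f @^-1` [set x] = [set w | forall i, X i w = x i].
  apply/seteqP; split => w /=; first by move=> <- i; rewrite ffunE.
  by move=> Xx; apply/ffunP => i; rewrite ffunE.
have mf x : measurable (f @^-1` [set x]).
  by rewrite fE; exact: measurable_spins.
have mYB : measurable (Y @^-1` B).
  by rewrite -[X in measurable X]setTI; exact: measurable_funP.
have mp : measurable [set w | p (f w)].
  rewrite (_ : [set w | _] = \bigcup_(x in [set x | p x]) f @^-1` [set x]).
    by apply: fin_bigcup_measurable => //; exact: finite_finset.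
  by apply/seteqP; split => [w pw|w [x px /= ->]//]; exists (f w).
rewrite (measure_partition P mf); last first.
  by apply: measurableI => //; apply: measurableI => //; exact: (measurable_G sync).
rewrite (eq_bigr (fun x : {ffun 'I_n -> spin} => if p x then
   \int[P]_(w in D) \sum_s (flip_density g (pred1 x) s (Y w) *
     \1_B (flip_outputs s (Y w)))%:E else 0)%E); last first.
  move=> x _; case: ifP => px.
    rewrite -spins_law// fE; congr (P _); apply/seteqP; split => w /=.
      by move=> [[_ [Gw YB]] Xx].
    move=> [[Xx Gw] YB]; split => //; split => //.
    by rewrite (_ : [ffun i => X i w] = x)//; apply/ffunP => i; rewrite ffunE.
  rewrite (_ : _ `&` _ = set0) ?measure0//.
  by apply/seteqP; split => // w /= [[pw _] fx]; move: px; rewrite -fx pw.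
rewrite -big_mkcond/= -big_filter -ge0_integral_sum//; last 2 first.
- move=> x; apply: (mD_sum (f := fun s y => flip_density g (pred1 x) s y *
     \1_B (flip_outputs s y))) => s.
  apply: measurable_funM; first exact: measurable_flip_density.
  apply: measurableT_comp; first exact: measurable_indic.
  exact: measurable_flip_outputs.
- move=> x w _; apply: sume_ge0 => s _; rewrite lee_fin mulr_ge0//.
  exact: flip_density_ge0.
apply: eq_integral => w _; rewrite big_filter exchange_big/=; apply: eq_bigr => s _.
rewrite sumEFin -mulr_suml; congr (_ * _)%:E.
rewrite /flip_density -mulr_sumr; congr (_ * _).
by apply: eq_bigr => x _; rewrite big_pred1_eq.
Qed.

Lemma integral_given_graph (phi : output Yt -> \bar R) :
  measurable_fun setT phi -> (forall y, 0 <= phi y)%E ->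
  (\int[P]_(w in [set w | G w = g]) phi (Y w) =
   \int[P]_(w in D) \sum_s (flip_density g predT s (Y w))%:E *
      phi (flip_outputs s (Y w)))%E.
Proof.
move=> mphi phi0.
have [m [mE mint]] := restricted_law P (measurable_G sync g)
  (measurable_funP Y : measurable_fun setT (Y : Omega -> output Yt)).
rewrite -(mint phi)//.
apply: (ge0_integral_weighted_pushforward
  (w := fun s w => flip_density g predT s (Y w))
  (f := fun s w => flip_outputs s (Y w))) => //.
- by move=> s; apply: (mYf (f := flip_density g predT s)); exact: measurable_flip_density.
- by move=> s; apply: (mYf (f := flip_outputs s)); exact: measurable_flip_outputs.
- by move=> s w; exact: flip_density_ge0.
move=> B mB; rewrite mE// -spins_pred_law//; congr (P _).
by apply/seteqP; split => // w [].
Qed.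

Let flipE s w u v : D w ->
  posterior_correlation u v (flip_outputs s (Y w)) =
  correlation g u v (flip_statistic s (Y w)) / evidence g (flip_statistic s (Y w)).
Proof.
move=> Dw; rewrite /posterior_correlation output_graph_map outG//.
have sE : {in g, statistic (flip_outputs s (Y w)) =1 flip_statistic s (Y w)}.
  by move=> e eg; rewrite statistic_flip// outG.
by rewrite (eq_correlation _ _ sE) (eq_evidence sE).
Qed.

(** The reweighting restricted to [x_u, x_v] equal to [z] is the full reweighting times [spin2_mass]
    at the posterior correlation. *)
Lemma posterior_pair_law u v (z : spin * spin) B : measurable B ->
  P ([set w | X u w = z.1 /\ X v w = z.2] `&`
     ([set w | G w = g] `&` Y @^-1` B)) =
  (\int[P]_(w in [set w | G w = g] `&` Y @^-1` B)
     (spin2_mass (posterior_correlation u v (Y w)) z)%:E)%E.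
Proof.
move=> mB.
rewrite (_ : [set w | X u w = z.1 /\ _] =
  [set w | (fun x : {ffun 'I_n -> spin} => (x u == z.1) && (x v == z.2))
     [ffun i => X i w]]); last first.
  apply/seteqP; split => w /=; rewrite !ffunE; first by move=> [-> ->]; rewrite !eqxx.
  by move=> /andP[/eqP -> /eqP ->].
rewrite (spins_pred_law (fun x => (x u == z.1) && (x v == z.2)) mB) [RHS]integral_mkcondr.
rewrite [RHS](eq_integral (fun w =>
   ((spin2_mass (posterior_correlation u v (Y w)) z * \1_B (Y w))%:E)%E)); last first.
  move=> w _; rewrite patchE indicE; have [yB|yB] := pselect (B (Y w)).
    by rewrite !mem_set// mulr1.
  by rewrite !memNset// mulr0.
rewrite (integral_given_graph (phi := fun y =>
   (spin2_mass (posterior_correlation u v y) z * \1_B y)%:E)).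
- apply: eq_integral => w; rewrite inE => Dw; apply: eq_bigr => s _.
  rewrite -EFinM mulrA; congr (_ * _)%:E.
  rewrite flipE// flip_density_predT flip_density_pair -[RHS]mulrA; congr (_ * _).
  have s1 : {in g, forall e, `|flip_statistic s (Y w) e| <= 1}.
    by move=> e _; exact: flip_statistic_le1.
  have := @correlation_le _ _ _ u v (flip_statistic s (Y w)) s1; rewrite /spin2_mass.
  (* Where the evidence vanishes so does the correlation, and both densities are 0. *)
  have [->|e0] := eqVneq (evidence g (flip_statistic s (Y w))) 0.
    by rewrite normr_le0 => /eqP ->; rewrite !mul0r mulr0 addr0 mulr0.
  by move=> _; field.
- apply/measurable_EFinP; apply: measurable_funM => //.
  apply: measurable_funM => //; apply: measurable_funD => //.
  by apply: measurable_funM => //; exact: measurable_posterior_correlation.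
- move=> y; rewrite lee_fin mulr_ge0// spin2_mass_ge0//.
  exact: posterior_correlation_le1.
Qed.

Variable gamma : edge n -> R.
Hypothesis gammaE : forall e, e \in g ->
  (\int[Q e true]_y (r e y ^+ 2)%:E)%E = (gamma e)%:E.

(** Each configuration has one factor per edge, [r_e ^+ 2] or [1 - r_e ^+ 2]; on [D] these factors
    depend on independent coordinates and have means [gamma e] and [1 - gamma e]. *)
Lemma integral_conn_prob_statistic u v :
  (\int[P]_(w in D) (conn_prob g (fun e => statistic (Y w) e ^+ 2) u v)%:E =
   P D * (conn_prob g gamma u v)%:E)%E.
Proof.
have gamma1 e : e \in g -> (\int[Q e true]_y (1 - r e y ^+ 2)%:E = (1 - gamma e)%:E)%E.
  move=> eg; have mr2 : measurable_fun setT (fun y : Yt e => r e y ^+ 2).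
    by apply: measurable_funX; exact: mr.
  have r2 (y : Yt e) : r e y ^+ 2 <= 1.
    by rewrite -real_normK ?num_real// expr_le1// r1.
  have : (\int[Q e true]_y (1 - r e y ^+ 2)%:E + \int[Q e true]_y (r e y ^+ 2)%:E =
      1)%E.
    rewrite -ge0_integralD//.
    - rewrite (eq_integral (cst 1%E)).
        by rewrite integral_cst// mul1e [LHS]probability_setT.
      by move=> y _; rewrite -EFinD subrK.
    - by move=> y _; rewrite lee_fin subr_ge0.
    - by apply/measurable_EFinP; exact: measurable_funB.
    - by move=> y _; rewrite lee_fin sqr_ge0.
    - exact/measurable_EFinP.
  rewrite gammaE//; case: (\int[_]_(_ in _) _)%E => [a| |] //= -[<-].
  by rewrite addrK.
have stat2 w e : statistic (Y w) e ^+ 2 <= 1.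
  by rewrite -real_normK ?num_real// expr_le1// r1.
have open0 w (o : graph n) : o \subset g ->
    0 <= open_prob g (fun e => statistic (Y w) e ^+ 2) o.
  move=> og; rewrite open_probE// prodr_ge0// => e _.
  by case: ifP => _; rewrite ?sqr_ge0// subr_ge0.
have piece (o : graph n) : o \subset g ->
  (\int[P]_(w in D) (open_prob g (fun e => statistic (Y w) e ^+ 2) o)%:E =
   P D * (open_prob g gamma o)%:E)%E.
  move=> og; rewrite open_probE//.
  pose h e (y : Yt e) := if e \in o then r e y ^+ 2 else 1 - r e y ^+ 2.
  rewrite -(integral_prod_coord sync (h := h)).
  - by apply: eq_integral => w _; rewrite open_probE.
  - move=> e; rewrite /h; case: (e \in o).
      by apply: measurable_funX; exact: mr.
    by apply: measurable_funB => //; apply: measurable_funX; exact: mr.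
  - move=> e y; rewrite /h; case: ifP => _; first exact: sqr_ge0.
    by rewrite subr_ge0 -real_normK ?num_real// expr_le1// r1.
  - by move=> e eg; rewrite /h; case: ifP => _; [exact: gammaE|exact: gamma1].
have mopen (o : graph n) : o \subset g -> measurable_fun setT
    (fun w => open_prob g (fun e => statistic (Y w) e ^+ 2) o).
  move=> og; apply: (mYf (f := fun y => open_prob g (fun e => statistic y e ^+ 2) o)).
  under eq_fun do rewrite open_probE// -big_enum/=.
  apply: measurable_prod => e _; case: (e \in o).
    by apply: measurable_funX; exact: measurable_statistic.
  by apply: measurable_funB => //; apply: measurable_funX; exact: measurable_statistic.
pose c (o : graph n) := (o \subset g) && connect (adj o) u v.
rewrite (eq_integral (fun w => \sum_(o : graph n)
   (if c o then (open_prob g (fun e => statistic (Y w) e ^+ 2) o)%:E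
    else 0))%E); last first.
  by move=> w _; rewrite /conn_prob -sumEFin big_mkcond.
rewrite ge0_integral_sum//.
- rewrite /conn_prob; have pf : P D \is a fin_num by exact: fin_num_measure.
  rewrite -(fineK pf) -EFinM mulr_sumr -sumEFin [RHS]big_mkcond/=.
  apply: eq_bigr => o _; rewrite -/(c o); case: ifP => co; last by rewrite integral0.
  by case/andP: co => og _; rewrite piece// -{1}(fineK pf).
- move=> o; have [co|//] := boolP (c o); case/andP: co => og _.
  by apply: measurable_funTS; apply/measurable_EFinP; exact: mopen.
- move=> o w _; have [co|//] := boolP (c o); case/andP: co => og _.
  by rewrite lee_fin open0.
Qed.

(** Evidence times squared posterior correlation is [chi2_density], whose sign average is bounded
    pointwise on [D]. The factor [K], the number of inputs, is the ratio of the probability of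
    [G = g] to that of [D]. *)
Lemma integral_posterior_correlation_le u v :
  (\int[P]_(w in [set w | G w = g]) (posterior_correlation u v (Y w) ^+ 2)%:E <=
   P [set w | G w = g] * (conn_prob g gamma u v)%:E)%E.
Proof.
pose K := #|{: {ffun 'I_n -> spin}}|%:R : R.
have KE : K = 2 ^+ n by rewrite /K card_ffun card_bool card_ord natrX.
have stat2 w e : `|statistic (Y w) e| <= 1 by exact: r1.
have PDE : (P [set w | G w = g] = K%:E * P D)%E.
  have K0 : (2 ^+ n : R) != 0 by rewrite expf_neq0// pnatr_eq0.
  by rewrite /D (probability_spins_graph sync) muleA -EFinM KE divff// mul1e.
have mconn : measurable_fun setT
    (fun w => conn_prob g (fun e => statistic (Y w) e ^+ 2) u v).
  apply: (mYf (f := fun y => conn_prob g (fun e => statistic y e ^+ 2) u v)).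
  rewrite /conn_prob; under eq_fun do rewrite -big_filter.
  apply: measurable_sum => o; rewrite /open_prob; apply: measurable_funM.
    under eq_fun do rewrite -big_enum/=.
    by apply: measurable_prod => e _; apply: measurable_funX; exact: measurable_statistic.
  under eq_fun do rewrite -big_enum/=.
  apply: measurable_prod => e _; apply: measurable_funB => //.
  by apply: measurable_funX; exact: measurable_statistic.
have conn0 w : 0 <= conn_prob g (fun e => statistic (Y w) e ^+ 2) u v.
  apply: sumr_ge0 => o _; apply: mulr_ge0; apply: prodr_ge0 => e _.
    exact: sqr_ge0.
  by rewrite subr_ge0 -real_normK ?num_real// expr_le1.
have mpost : measurable_fun setT
    (fun y => (posterior_correlation u v y ^+ 2)%:E).
  apply/measurable_EFinP; apply: measurable_funX.
  exact: measurable_posterior_correlation.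
rewrite (integral_given_graph mpost); last by move=> y; rewrite lee_fin sqr_ge0.
rewrite PDE -muleA -integral_conn_prob_statistic -ge0_integralZl//; last 3 first.
- by apply/measurable_EFinP; exact: measurable_funTS.
- by move=> w _; rewrite lee_fin.
- by rewrite lee_fin /K.
apply: ge0_le_integral => //.
- move=> w _; apply: sume_ge0 => s _; rewrite -EFinM lee_fin mulr_ge0//.
    exact: flip_density_ge0.
  exact: sqr_ge0.
- apply: (mD_sum (f := fun s y => flip_density g predT s y *
     posterior_correlation u v (flip_outputs s y) ^+ 2)) => s.
  apply: measurable_funM; first exact: measurable_flip_density.
  apply: measurable_funX; apply: measurableT_comp; last exact: measurable_flip_outputs.
  exact: measurable_posterior_correlation.
- apply: measurable_funeM; apply/measurable_EFinP; exact: measurable_funTS.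
move=> w Dw; rewrite -EFinM.
rewrite (eq_bigr (fun s : {ffun edge n -> spin} =>
   (K * (chi2_density g u v (flip_statistic s (Y w)) / card_s))%:E)); last first.
  move=> s _; rewrite -EFinM; congr EFin.
  rewrite flipE// flip_density_predT /chi2_density -/K.
  have [->|e0] := eqVneq (evidence g (flip_statistic s (Y w))) 0.
    by rewrite invr0 !(mulr0, mul0r).
  by field; rewrite e0 s0.
rewrite sumEFin lee_fin -mulr_sumr ler_wpM2l//.
by rewrite -mulr_suml; exact: avg_chi2_density_le.
Qed.

End posterior.

(* Edges of probability zero need not be symmetric; they get the trivial
   statistic. *)
Lemma edge_statistic_exists (R : realType) (n : nat) (d : edge n -> measure_display)
    (Yt : forall e, measurableType (d e)) (Q : forall e, spin -> probability (Yt e) R)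
    (e : edge n) :
  exists Tr : (Yt e -> Yt e) * (Yt e -> R),
  [/\ measurable_fun setT Tr.1, measurable_fun setT Tr.2,
      forall y, `|Tr.2 y| <= 1, forall y, Tr.2 (Tr.1 y) = - Tr.2 y &
      symmetric_edge_channel Q e ->
        (forall b A, measurable A -> (Q e b A = \int[Q e true]_y \sum_(c : spin)
           (2^-1 * ((1 + sgn R b * (sgn R c * Tr.2 y)) *
                    \1_A (flip_output Tr.1 c y)))%:E)%E) /\
        (\int[Q e true]_y (Tr.2 y ^+ 2)%:E = (edge_gamma Q e)%:E)%E].
Proof.
have [[T [mT TK QT]]|nsym] := pselect (symmetric_edge_channel Q e); last first.
  exists (idfun, fun=> 0); split => //=; first exact: measurable_id.
    by move=> y; rewrite normr0.
  by move=> y; rewrite oppr0.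
have [r [mr r1 rT Qr rE]] := symmetric_edge_statistic mT TK QT.
exists (T, r); split => // _; split => //=.
rewrite /edge_gamma rE fineK// ge0_fin_numE; last first.
  by apply: integral_ge0 => y _; rewrite lee_fin sqr_ge0.
apply: (@le_lt_trans _ _ (\int[Q e true]_y (cst 1 y)))%E.
  apply: ge0_le_integral => //.
  - by move=> y _; rewrite lee_fin sqr_ge0.
  - by apply/measurable_EFinP; exact: measurable_funX.
  - by move=> y _; rewrite lee_fin -real_normK ?num_real// expr_le1.
by rewrite integral_cst// mul1e [ltLHS]probability_setT ltry.
Qed.

Theorem theorem3p6 (R : realType) (n : nat)
    (d : edge n -> measure_display) (Yt : forall e, measurableType (d e))
    (Q : forall e, spin -> probability (Yt e) R)
    (dO : measure_display) (Omega : measurableType dO)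
    (P : probability Omega R)
    (G : Omega -> graph n) (X : 'I_n -> {RV P >-> spin})
    (Y : {RV P >-> output Yt}) :
  symmetric_channel Q P G -> sync_instance Q G X Y ->
  forall u v : 'I_n,
    (cond_chi2_mi P (X u) (X v) Y <= random_conn_prob P G (edge_gamma Q) u v)%E.
Proof.
move=> sym sync u v.
pose Tr e := sval (cid (edge_statistic_exists Q e)).
have TrP e := svalP (cid (edge_statistic_exists Q e)).
pose T e := (Tr e).1; pose r e := (Tr e).2.
have mT e : measurable_fun setT (T e) by case: (TrP e).
have mr e : measurable_fun setT (r e) by case: (TrP e).
have r1 e y : `|r e y| <= 1 by case: (TrP e) => _ _ + _ _; apply.
have rT e y : r e (T e y) = - r e y by case: (TrP e) => _ _ _ + _; apply.
have mG := measurable_G sync.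
(* An edge of a graph of positive probability occurs with positive probability, so its channel is
   symmetric. *)
have symE g : (0 < P [set w | G w = g])%E ->
    forall e, e \in g -> symmetric_edge_channel Q e.
  move=> g0 e eg; apply: sym; apply: (lt_le_trans g0).
  apply: le_measure; rewrite ?inE//; last by move=> w /= ->.
  rewrite (_ : [set w | e \in G w] =
    \bigcup_(h in [set h : graph n | e \in h]) [set w | G w = h]).
    by apply: fin_bigcup_measurable => //; exact: finite_finset.
  by apply/seteqP; split => [w eG|w [h /= eh ->]//]; exists (G w).
have mY B : measurable B -> measurable (Y @^-1` B).
  by move=> mB; rewrite -[X in measurable X]setTI; exact: measurable_funP.
have mrho := measurable_posterior_correlation mr r1 u v.
have rho1 := posterior_correlation_le1 r1 u v.
have mrhoY : measurable_fun setT (fun w => posterior_correlation r u v (Y w)).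
  exact: measurableT_comp.
have mpair (z : spin * spin) : measurable [set w | X u w = z.1 /\ X v w = z.2].
  apply: measurableI; rewrite -[X in measurable X]setTI.
    exact: (measurable_funP (X u)) measurableT _ (I : measurable [set z.1]).
  exact: (measurable_funP (X v)) measurableT _ (I : measurable [set z.2]).
rewrite (cond_chi2_mi_spin2 (rho := posterior_correlation r u v))//; last first.
  move=> z B mB.
  rewrite (measure_partition P mG); last by apply: measurableI => //; exact: mY.
  rewrite (ge0_integral_partition P mG); first last.
  - by move=> w _; rewrite lee_fin spin2_mass_ge0.
  - apply/measurable_EFinP; apply: measurable_funTS; apply: measurable_funM => //.
    by apply: measurable_funD => //; exact: measurable_funM.
  - exact: mY.
  (* On a graph of probability zero the channels need not be symmetric, but both sides vanish. *)
  apply: eq_bigr => g _; have [g0|g0] := eqVneq (P [set w | G w = g]) 0%E.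
    have mYB := mY _ mB; have mg := mG g.
    transitivity (0%E : \bar R).
      apply: (subset_measure0 _ mg _ g0) => [|w []//].
      by do 2 apply: measurableI => //.
    apply/esym; apply: null_set_integral.
    - exact: measurableI.
    - apply/measurable_EFinP; apply: measurable_funTS; apply: measurable_funM => //.
      by apply: measurable_funD => //; exact: measurable_funM.
    - by apply: (subset_measure0 _ mg _ g0); [exact: measurableI|move=> w []].
  have {}g0 : (0 < P [set w | G w = g])%E by rewrite lt_neqAle eq_sym g0 measure_ge0.
  rewrite -setIA [X in _ `&` X]setIC [in RHS]setIC.
  apply: (posterior_pair_law sync mT mr r1 rT) => // e eg.
  by case: (TrP e) => _ _ _ _ /(_ (symE _ g0 e eg))[].
rewrite (ge0_integral_partition P mG)//; last 2 first.
- by apply/measurable_EFinP; exact: measurable_funX.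
- by move=> w _; rewrite lee_fin sqr_ge0.
apply: lee_sum => g _; rewrite setTI.
have [g0|g0] := eqVneq (P [set w | G w = g]) 0%E.
  rewrite g0 mul0e le_eqVlt; apply/orP; left; apply/eqP.
  apply: null_set_integral; [exact: mG| |exact: g0].
  by apply/measurable_EFinP; apply: measurable_funTS; exact: measurable_funX.
have {}g0 : (0 < P [set w | G w = g])%E by rewrite lt_neqAle eq_sym g0 measure_ge0.
apply: (integral_posterior_correlation_le sync mT mr r1 rT) => // e eg.
  by case: (TrP e) => _ _ _ _ /(_ (symE _ g0 e eg))[].
by case: (TrP e) => _ _ _ _ /(_ (symE _ g0 e eg))[].
Qed.
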